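(* Let $\mathcal A=C(M)$ be commutative (with $\mathcal Z=\mathcal A$) and assume that, for every $g\in G$, $\alpha_g: a\mapsto U_g a U_g^*$ is a $*$-automorphism of $\mathcal A$. Suppose that for every finite set $G_0\subset G\setminus\{e\}$, all $c_g\in\mathbb C$ ($g\in G_0$), and every non-empty open set $V\subset M$ satisfying $\beta_g|_V=\mathrm{id}_V$ for all $g\in G_0$, there exists $z_V\in\mathcal Z(V)$ such that $$\Big\|z_V\Big(I+\sum_{g\in G_0}c_gU_g\Big)\Big\|\ \ge\ \|z_V\|=1 .$$ Then for every finite set $D\subset G$, every non-empty open set $V\subset M$ such that $\beta_g|_V=\mathrm{id}_V$ for all $g\in D$, and all $a_g\in\mathcal A$ ($g\in D$), there exists $z_V\in\mathcal Z(V)$ with $$\|z_Va_e\|\le\Big\|z_V\sum_{g\in D}a_gU_g\Big\| .$$ If moreover the action $\alpha$ is amenable, then $\mathrm{id}\rtimes U:\mathcal A\rtimes_\alpha G\to\mathcal B$ is an isomorphism.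
   Context: Setting. $H$ is a Hilbert space, $\mathcal A\subset B(H)$ is a unital $C^*$-subalgebra with $1_{\mathcal A}=I$, $G$ is a discrete group with identity $e$, and $U:G\to B(H)$, $g\mapsto U_g$, is a unitary representation. $\alpha:G\to\mathrm{Aut}(\mathcal A)$ is the action $\alpha_g(a)=U_gaU_g^*$. $\mathcal B\subset B(H)$ is the $C^*$-algebra generated by $\mathcal A$ and $\{U_g:g\in G\}$; it is the closure of the set of finite sums $\sum_{g\in G_0}a_gU_g$, $a_g\in\mathcal A$. Here $\mathcal A=\mathcal Z$ is commutative, $M$ is its compact Hausdorff maximal ideal (character) space, and $\mathcal A$ is identified with $C(M)$ by the Gelfand transform. For $g\in G$, $\beta_g:M\to M$ is the homeomorphism with $z(\beta_g(m))=(\alpha_g(z))(m)$ for $z\in C(M)$, $m\in M$. For a non-empty open $V\subset M$, $\mathcal Z(V)=\{z\in C(M):0\le z\le1,\ \|z\|=1,\ \mathrm{supp}\,z\subset V\}$. Convention: $a_e:=0$ if $e\notin D$. Amenable action: let $C_c(G,\mathcal A)$ be the finitely supported functions $G\to\mathcal A$, and $\|f\|_2=\|\sum_gf(g)f(g)^*\|^{1/2}$. The action $\alpha$ is amenable if there are finitely supported functions $x_i:G\to\mathcal A$, $i\in\mathbb N$, with values in the center of $\mathcal A$, such that $x_i(g)\ge0$ for all $i,g$; $\sum_gx_i(g)^2=1_{\mathcal A}$ for all $i$; and $\|\delta_s*x_i-x_i\|_2\to0$ for all $s\in G$, where $(\delta_s*x_i)(g)=\alpha_s(x_i(s^{-1}g))$.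 $\mathcal A\rtimes_\alpha G$ is the full (universal) crossed product, and $\mathrm{id}\rtimes U$ is the canonical surjective $*$-homomorphism onto $\mathcal B$ determined by $f\mapsto\sum_gf(g)U_g$ for $f\in C_c(G,\mathcal A)$. *)

(* Defs.v *)
From HB Require Import structures.
From mathcomp Require Import all_boot all_order all_algebra sesquilinear complex.
From mathcomp Require Import all_classical all_reals all_analysis.

Set Implicit Arguments.
Unset Strict Implicit.
Unset Printing Implicit Defensive.

Import Order.TTheory GRing.Theory Num.Theory.
Import numFieldNormedType.Exports.

Local Open Scope classical_set_scope.
Local Open Scope ring_scope.

(* The scalar product is linear in its first argument. *)
HB.mixin Record isHilbert (R : realType) H of CompleteNormedModule R[i] H := {
  inner : {dot H for (@Num.conj R[i])} ;
  normE : forall x : H, `|x| ^+ 2 = inner x x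
}.

#[short(type="hilbertType")]
HB.structure Definition Hilbert (R : realType) :=
  {H of isHilbert R H & CompleteNormedModule R[i] H}.

Section BoundedOperators.
Variables (R : realType) (H : hilbertType R).

(* The norm of H takes its values in R[i]; this is the same norm as a real. *)
Definition hnorm (x : H) : R := complex.Re `|x|.

Definition bounded_linear : {pred H -> H} :=
  fun T => `[< linear T /\ exists M : R, forall x, hnorm (T x) <= M * hnorm x >].

Record bop := Bop { bop_fun :> H -> H ; _ : bop_fun \in bounded_linear }.

HB.instance Definition _ := [isSub for bop_fun].
HB.instance Definition _ := [Choice of bop by <:].

Lemma hnorm_ge0 x : 0 <= hnorm x.
Proof. by have := normr_ge0 x; rewrite lecE => /andP[]. Qed.

Lemma hnormE x : `|x| = (hnorm x)%:C%C.
Proof. by rewrite /hnorm RRe_real// normr_real. Qed.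

Lemma ler_hnormD x y : hnorm (x + y) <= hnorm x + hnorm y.
Proof. by rewrite -lecR raddfD/= -!hnormE ler_normD. Qed.

Lemma hnormZ c x : hnorm (c *: x) = complex.Re `|c| * hnorm x.
Proof.
rewrite {1}/hnorm normrZ hnormE -{1}(RRe_real (normr_real c)).
by rewrite -rmorphM.
Qed.

Lemma bop_subproof (T : bop) :
  linear T /\ exists M : R, forall x, hnorm (T x) <= M * hnorm x.
Proof. by case: T => T hT /=; apply/asboolP; rewrite unfold_in in hT. Qed.

Fact bounded_linear_submod_closed : submod_closed bounded_linear.
Proof.
split=> [|c S T]; rewrite !unfold_in.
  apply/asboolP; split=> [k x y|]; first by rewrite /= scaler0 addr0.
  by exists 0 => x; rewrite mul0r /hnorm normr0.
move=> /asboolP[linS [M hM]] /asboolP[linT [N hN]]; apply/asboolP.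
split=> [k x y|].
  rewrite /= !fctE/= linS linT.
  by rewrite !scalerDr !scalerA addrACA [k * c]GRing.mulrC.
exists (complex.Re `|c| * M + N) => x.
rewrite (le_trans (ler_hnormD _ _))// mulrDl lerD// hnormZ -mulrA.
by rewrite ler_wpM2l//; have := normr_ge0 c; rewrite lecE => /andP[].
Qed.
HB.instance Definition _ :=
  GRing.isSubmodClosed.Build R[i] (H -> H) bounded_linear
    bounded_linear_submod_closed.
HB.instance Definition _ := [SubChoice_isSubLmodule of bop by <:].

Fact bop_id_subproof : idfun \in bounded_linear.
Proof. by rewrite unfold_in; apply/asboolP; split=> //; exists 1 => x; rewrite mul1r. Qed.

Fact bop_comp_subproof (S T : bop) : S \o T \in bounded_linear.
Proof.
have [linS [M hM]] := bop_subproof S; have [linT [N hN]] := bop_subproof T.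
rewrite unfold_in; apply/asboolP; split=> [k x y|]; first by rewrite /= linT linS.
exists (`|M| * N) => x; rewrite (le_trans (hM _))//.
rewrite (le_trans (ler_wpM2r (hnorm_ge0 _) (ler_norm M)))//.
by rewrite -mulrA ler_wpM2l.
Qed.

Lemma bopP (S T : bop) : (forall x, S x = T x) -> S = T.
Proof. by move=> ST; apply/val_inj/funext. Qed.

Definition bop_one := Bop bop_id_subproof.
Definition bop_mul S T := Bop (bop_comp_subproof S T).

Fact bop_mulA : associative bop_mul. Proof. by move=> *; exact: bopP. Qed.
Fact bop_mul1 : left_id bop_one bop_mul. Proof. by move=> *; exact: bopP. Qed.
Fact bop_mulr1 : right_id bop_one bop_mul. Proof. by move=> *; exact: bopP. Qed.
Fact bop_mulDl : left_distributive bop_mul +%R.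
Proof. by move=> *; exact: bopP. Qed.
Fact bop_mulDr : right_distributive bop_mul +%R.
Proof.
move=> S T T'; apply: bopP => x /=; have [linS _] := bop_subproof S.
by have := linS 1 (T x) (T' x); rewrite !scale1r.
Qed.

HB.instance Definition _ := GRing.Zmodule_isPzRing.Build bop
  bop_mulA bop_mul1 bop_mulr1 bop_mulDl bop_mulDr.

Definition opnorm (T : bop) : R :=
  sup [set hnorm (T x) | x in [set x | hnorm x <= 1]].

(* The adjoint exists and is unique by the Riesz representation theorem, so the
   default value is never used. *)
Definition adj (T : bop) : bop :=
  xget 0 [set S : bop | forall x y, inner (T x) y = inner x (S y)].

(* The order of R[i] makes this say that every inner (T x) x is real and
   nonnegative. *)
Definition positive_op (T : bop) := forall x, 0 <= inner (T x) x.

Definition unitary_op (T : bop) := adj T * T = 1 /\ T * adj T = 1.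

Definition cstar_subalgebra (A : set bop) :=
  [/\ A 1 /\ (forall a b, A a -> A b -> A (a + b)),
      forall (c : R[i]) a, A a -> A (c *: a),
      forall a b, A a -> A b -> A (a * b),
      forall a, A a -> A (adj a) &
      forall T, (forall e : R, 0 < e -> exists2 a, A a & opnorm (T - a) < e) ->
        A T].

Definition center (A : set bop) : set bop :=
  [set a | A a /\ forall b, A b -> a * b = b * a].

End BoundedOperators.

Notation "''B' ( H )" := (bop H) (format "''B' ( H )") : type_scope.

Section Morphisms.
Variables (R : realType) (H K : hilbertType R).

Definition star_morphism (A : set 'B(H)) (phi : 'B(H) -> 'B(K)) :=
  [/\ forall a b, A a -> A b -> phi (a + b) = phi a + phi b,
      forall (c : R[i]) a, A a -> phi (c *: a) = c *: phi a,
      forall a b, A a -> A b -> phi (a * b) = phi a * phi b &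
      forall a, A a -> phi (adj a) = adj (phi a)].

End Morphisms.

Definition star_automorphism (R : realType) (H : hilbertType R)
    (A : set 'B(H)) (phi : 'B(H) -> 'B(H)) :=
  set_bij A A phi /\ star_morphism A phi.

Definition unitary_rep (R : realType) (H : hilbertType R) (G : groupType)
    (U : G -> 'B(H)) :=
  [/\ U 1%g = 1, forall g h, U (g * h)%g = U g * U h &
      forall g, unitary_op (U g)].

Section Characters.
Variables (R : realType) (H : hilbertType R) (A : set 'B(H)).

(* A character is a functional on A; it is recorded as its extension by 0 to
   B(H), so that two characters agreeing on A are equal. *)
Definition is_character (chi : 'B(H) -> R[i]) :=
  [/\ chi 1 = 1,
      forall a b, A a -> A b -> chi (a + b) = chi a + chi b,
      forall (c : R[i]) a, A a -> chi (c *: a) = c * chi a,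
      forall a b, A a -> A b -> chi (a * b) = chi a * chi b &
      forall T, ~ A T -> chi T = 0].

Record character := Character {
  char_fun :> 'B(H) -> R[i] ;
  char_funP : is_character char_fun
}.

HB.instance Definition _ := gen_eqMixin character.
HB.instance Definition _ := gen_choiceMixin character.

Definition char_ptws (chi : character) : {ptws 'B(H) -> R[i]^o} := chi.

(* The Gelfand (pointwise convergence) topology.  The Gelfand transform of
   a in A is the function chi |-> chi a. *)
HB.instance Definition _ :=
  Topological.copy character (initial_topology char_ptws).

(* The functions z in C(M) = A with 0 <= z <= 1, norm 1 and support inside V. *)
Definition bumps (V : set character) : set 'B(H) :=
  [set z | [/\ A z,
               forall chi : character, 0 <= chi z <= 1,
               opnorm z = 1 &
               closure [set chi : character | chi z != 0] `<=` V]].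

End Characters.

Section Action.
Variables (R : realType) (H : hilbertType R) (G : groupType).

Definition alpha (U : G -> 'B(H)) (g : G) (a : 'B(H)) : 'B(H) :=
  U g * a * adj (U g).

Fact beta_subproof (A : set 'B(H)) (phi : 'B(H) -> 'B(H)) :
  cstar_subalgebra A -> star_automorphism A phi -> forall chi : character A,
  is_character A (fun T => if T \in A then chi (phi T) else 0).
Proof.
move=> [[A1 AD] AZ AM _ _] [[phiA _ phisurj] [phiD phiZ phiM _]] chi.
have [chi1 chiD chiZ chiM _] := char_funP chi.
have phi1 : phi 1 = 1.
  by have [b Ab b1] := phisurj _ A1; rewrite -{2}b1 -[b]mul1r phiM// b1 mulr1.
split=> [|a b Aa Ab|c a Aa|a b Aa Ab|T nAT].
- by rewrite mem_set// phi1.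
- by rewrite !mem_set//; [rewrite phiD// chiD//; exact: phiA|exact: AD].
- by rewrite !mem_set//; [rewrite phiZ// chiZ//; exact: phiA|exact: AZ].
- by rewrite !mem_set//; [rewrite phiM// chiM//; exact: phiA|exact: AM].
- by rewrite memNset.
Qed.

(* The map of the character space induced by an automorphism phi of A:
   (beta m)(z) = m (phi z) for z in A. *)
Definition beta (A : set 'B(H)) (phi : 'B(H) -> 'B(H))
    (hA : cstar_subalgebra A) (hphi : star_automorphism A phi)
    (m : character A) : character A :=
  Character (beta_subproof hA hphi m).

Definition Cc (A : set 'B(H)) : set (G -> 'B(H)) :=
  [set f | finite_set [set g | f g != 0] /\ forall g, A (f g)].

Definition norm2 (f : G -> 'B(H)) : R :=
  Num.sqrt (opnorm (\sum_(g \in [set: G]) f g * adj (f g))).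

Definition amenable_action (A : set 'B(H)) (al : G -> 'B(H) -> 'B(H)) :=
  exists x : nat -> G -> 'B(H),
    [/\ forall i, Cc A (x i) /\ (forall g, center A (x i g)),
        forall i g, positive_op (x i g),
        forall i, \sum_(g \in [set: G]) x i g ^+ 2 = 1 &
        forall s : G,
          (fun i => norm2 (fun g => al s (x i (s^-1 * g)%g) - x i g))
            @ \oo --> (0 : R)].

Definition generated_cstar (A : set 'B(H)) (U : G -> 'B(H)) : set 'B(H) :=
  smallest (@cstar_subalgebra R H) (A `|` range U).

End Action.

Section CrossedProduct.
Variables (R : realType) (H : hilbertType R) (G : groupType).
Variables (A : set 'B(H)) (al : G -> 'B(H) -> 'B(H)).

(* Only the values of cov_pi on A are constrained or used. *)
Record covariant_rep := CovariantRep {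
  cov_space : hilbertType R ;
  cov_pi : 'B(H) -> 'B(cov_space) ;
  cov_u : G -> 'B(cov_space) ;
  cov_pi1 : cov_pi 1 = 1 ;
  cov_pi_morphism : star_morphism A cov_pi ;
  cov_u_unitary : unitary_rep cov_u ;
  cov_covariant : forall g a, A a ->
    cov_u g * cov_pi a * adj (cov_u g) = cov_pi (al g a)
}.

Definition integrated (w : covariant_rep) (f : G -> 'B(H)) :
    'B(cov_space w) :=
  \sum_(g \in [set g | f g != 0]) cov_pi w (f g) * cov_u w g.

Definition rep_family := forall w : covariant_rep, 'B(cov_space w).

Definition family_add (S T : rep_family) : rep_family := fun w => S w + T w.
Definition family_scale (c : R[i]) (T : rep_family) : rep_family :=
  fun w => c *: T w.
Definition family_mul (S T : rep_family) : rep_family := fun w => S w * T w.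
Definition family_adj (T : rep_family) : rep_family := fun w => adj (T w).

(* The full crossed product is the completion of the convolution *-algebra
   Cc A in the norm f |-> sup_w opnorm (integrated w f), w ranging over all
   covariant representations.  It is realized in its universal representation:
   as the closure, for the sup norm, of the image of Cc A in the product over
   all w of the algebras B(cov_space w), with componentwise operations. *)
Definition full_crossed_product (T : rep_family) : Prop :=
  forall e : R, 0 < e ->
    exists2 f : G -> 'B(H), Cc A f &
      forall w, opnorm (T w - integrated w f) <= e.

Definition crossed_star_isomorphism (K : hilbertType R) (B : set 'B(K))
    (Phi : rep_family -> 'B(K)) :=
  [/\ forall T, full_crossed_product T -> B (Phi T),
      forall S T, full_crossed_product S -> full_crossed_product T ->
        Phi S = Phi T -> S = T &
      forall b, B b -> exists2 T, full_crossed_product T & Phi T = b] /\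
  [/\ forall S T, full_crossed_product S -> full_crossed_product T ->
        Phi (family_add S T) = Phi S + Phi T,
      forall c T, full_crossed_product T ->
        Phi (family_scale c T) = c *: Phi T,
      forall S T, full_crossed_product S -> full_crossed_product T ->
        Phi (family_mul S T) = Phi S * Phi T &
      forall T, full_crossed_product T -> Phi (family_adj T) = adj (Phi T)].

End CrossedProduct.

Section IdU.
Variables (R : realType) (H : hilbertType R) (G : groupType).
Variables (A : set 'B(H)) (U : G -> 'B(H)) (hU : unitary_rep U).

Fact id_star_morphism : star_morphism A (@idfun 'B(H)). Proof. by []. Qed.

Definition id_covariant_rep : covariant_rep A (alpha U) :=
  CovariantRep (erefl : @idfun 'B(H) 1 = 1) id_star_morphism hU
    (fun g a _ => erefl).

(* Evaluation at the covariant representation (inclusion of A, U): it sends the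
   element fun w => integrated w f given by f in Cc A to
   \sum_g f g * U g. *)
Definition id_rtimes_U (T : rep_family A (alpha U)) : 'B(H) :=
  T id_covariant_rep.

End IdU.

(* Main.v *)
Require Import Defs.
From mathcomp Require Import all_boot all_order all_algebra sesquilinear complex.
From mathcomp Require Import ring lra.
From mathcomp Require Import all_classical all_reals all_analysis.

Set Implicit Arguments.
Unset Strict Implicit.
Unset Printing Implicit Defensive.

Import Order.TTheory GRing.Theory Num.Theory.
Import numFieldNormedType.Exports.

Local Open Scope classical_set_scope.
Local Open Scope ring_scope.

Local Notation Re := complex.Re.
Local Notation Im := complex.Im.

(** The first assertion is local on the character space M. At a character m near which
    all [g] in [D] act trivially, each [a_g] is almost the scalar [a_g(m)], so that a
    bump z near m turns [sum a_g U_g] into [a_e(m)] times some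
    [z (I + sum c_g U_g)], whose norm is bounded below by hypothesis
    (fixed_points_estimate). The passage from pointwise to norm estimates is the
    isometry of the Gelfand transform, [|a| = sup |chi a|] (gelfand_le,
    norming_character). Its characters come from maximal preorderings of the real
    algebra of selfadjoint elements: Zorn's lemma gives such a preordering, it is
    total, and comparison with scalars is a character.

    For arbitrary finite sums this yields the contractive expectation
    [|a_e| <= |sum a_g U_g|]: near any point there is an open set V on which each of
    the finitely many [g] acts trivially or which it moves off itself (shrink_open),
    and for z supported in V the compression [z (sum a_g U_g) z] only keeps the terms
    of the first kind (expectation_contractive, coef_contractive).

    Let the action be amenable and [(pi, u)] a covariant representation on K. A
    finitely supported x with [sum x_s^2 = 1] gives an isometry from K to
    [l^2(G, K)], hence a compression phi of the representation
    [lambda (x) (pi, u)] of the finite sums. It satisfies the Kadison-Schwarz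
    inequality [|phi F|^2 <= |phi (F* F)|], and [|phi F| <= C |F|] for the norm
    [|F|] of the sum in B(H), because phi only sees finitely many coefficients,
    which the expectation controls. Iterating [F -> F* F] removes the constant:
    [|phi F| <= |F|] (phi_contractive). When x runs through the approximately
    invariant sequence, phi converges to [(pi, u)] (theta_close), so the norm of a
    finite sum in any covariant representation is at most its norm in B(H)
    (amenable_norm_le). Thus the universal norm is the norm of B(H), and the
    isomorphism follows by completion. *)

(** * Moduli of complex scalars and the real inner product *)

Definition cabs (R : realType) (z : R[i]) : R := Re `|z|.

Section Scalars.
Variable R : realType.
Implicit Types z w : R[i].

Lemma cabs_ge0 z : 0 <= cabs z.
Proof. by have := normr_ge0 z; rewrite lecE => /andP[]. Qed.

Lemma cabsE z : `|z| = (cabs z)%:C%C.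
Proof. by rewrite /cabs RRe_real// normr_real. Qed.

Lemma cabsM z w : cabs (z * w) = cabs z * cabs w.
Proof. by apply: complexI; rewrite rmorphM /= -!cabsE normrM. Qed.

Lemma cabsD z w : cabs (z + w) <= cabs z + cabs w.
Proof. by rewrite -lecR rmorphD /= -!cabsE ler_normD. Qed.

Lemma cabs_real (r : R) : cabs r%:C%C = `|r|.
Proof. by rewrite /cabs normc_def /= expr0n addr0 sqrtr_sqr. Qed.

Lemma cabsN z : cabs (- z) = cabs z.
Proof. by rewrite /cabs normrN. Qed.

Lemma cabs0 : cabs (0 : R[i]) = 0.
Proof. by rewrite /cabs normr0. Qed.

Lemma cabs1 : cabs (1 : R[i]) = 1.
Proof. by rewrite /cabs normr1. Qed.

Lemma cabs_eq0 z : (cabs z == 0) = (z == 0).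
Proof. by rewrite -[RHS]normr_eq0 cabsE -(inj_eq (@complexI R)). Qed.

Lemma cabsV z : cabs z^-1 = (cabs z)^-1.
Proof. by apply: complexI; rewrite -cabsE normfV cabsE fmorphV. Qed.

Lemma sqr_cabs z : cabs z ^+ 2 = Re z ^+ 2 + Im z ^+ 2.
Proof.
by apply: complexI; rewrite rmorphXn /= -cabsE -add_Re2_Im2 rmorphD.
Qed.

Lemma inv_nat_small (e : R) : 0 < e ->
  exists N : nat, forall n, (N <= n)%N -> n.+1%:R^-1 <= e.
Proof.
move=> e0; exists (Num.bound e^-1) => n Nn.
rewrite invf_ple ?posrE// ltW//.
rewrite (lt_le_trans (archi_boundP _)) ?invr_ge0 ?(ltW e0)// ler_nat.
exact: leqW.
Qed.

(** If [x > y > 0], Bernoulli's inequality makes [(x / y)^(2^k)] unbounded in k.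
    The constant C absorbs any loss that does not grow with k. *)
Lemma power_trick (C x y : R) : 0 <= y ->
  (forall k, x ^+ (2 ^ k) <= C * y ^+ (2 ^ k)) -> x <= y.
Proof.
move=> y0 H; rewrite leNgt; apply/negP => yx.
have x0 : 0 < x := le_lt_trans y0 yx.
have C0 : 0 < C.
  have := H 0%N; rewrite expn0 !expr1 => Hx.
  rewrite ltNge; apply/negP => C0.
  by have := lt_le_trans x0 Hx; rewrite ltNge mulr_le0_ge0.
pose d := (x - y) / x.
have d0 : 0 < d by rewrite divr_gt0// subr_gt0.
have bern n : 1 + n%:R * ((x - y) / x) <= (1 + (x - y) / x) ^+ n.
  elim: n => [|n IH]; first by rewrite mul0r addr0 expr0.
  rewrite exprS (le_trans _ (ler_wpM2l _ IH))//; last first.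
    by rewrite addr_ge0// ltW.
  rewrite -subr_ge0 -/d (_ : _ - _ = d ^+ 2 * n%:R); last first.
    by rewrite -natr1; ring.
  by rewrite mulr_ge0// sqr_ge0.
have step : y * (1 + d) <= x.
  have -> : x = y + x * d by rewrite /d mulrCA mulfV ?gt_eqF// mulr1 addrC subrK.
  by rewrite mulrDr mulr1 lerD2l ler_wpM2r// ltW.
have [k Ck] : exists k, C < (1 + d) ^+ (2 ^ k).
  have [n Cn] : exists n : nat, C / d < n%:R.
    exists (Num.bound (C / d)).
    by apply: archi_boundP; rewrite divr_ge0// ltW.
  exists n; apply: lt_le_trans (bern _).
  rewrite ltr_pdivrMr// in Cn; rewrite (lt_le_trans Cn)//.
  rewrite ler_wpDl// ler_wpM2r ?(ltW d0)// ler_nat ltnW// ltn_expl//.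
have [yE|y_neq0] := eqVneq y 0.
  by have := lt_le_trans x0 (H 0%N); rewrite yE expn0 expr1 mulr0 ltxx.
have {}y0 : 0 < y by rewrite lt0r y_neq0.
have := H k; rewrite leNgt => /negP; apply.
apply: (@lt_le_trans _ _ ((y * (1 + d)) ^+ (2 ^ k))).
  by rewrite exprMn mulrC ltr_pM2l// exprn_gt0.
by rewrite lerXn2r// nnegrE ?ltW// mulr_gt0// addr_gt0.
Qed.

End Scalars.

Section HilbertSpace.
Variables (R : realType) (H : hilbertType R).
Implicit Types x y z : H.

Lemma innerDl x y z : inner (x + y) z = inner x z + inner y z.
Proof. exact: linearDl. Qed.

Lemma innerDr x y z : inner x (y + z) = inner x y + inner x z.
Proof. exact: linearDr. Qed.

Lemma innerZl (c : R[i]) x y : inner (c *: x) y = c * inner x y.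
Proof. by rewrite linearZl_LR. Qed.

Lemma innerC x y : inner x y = (inner y x)^*.
Proof. by rewrite hermC expr0 mul1r. Qed.

Lemma innerBl x y z : inner (x - y) z = inner x z - inner y z.
Proof. exact: linearBl. Qed.

Lemma innerBr x y z : inner x (y - z) = inner x y - inner x z.
Proof. exact: linearBr. Qed.

(** Estimates are made with the real part, so that they stay in R; inner_rin
    recovers the complex inner product. *)
Definition rin x y : R := Re (inner x y).

Lemma rinC x y : rin x y = rin y x.
Proof. by rewrite /rin innerC; case: (inner y x). Qed.

Lemma rinDl x y z : rin (x + y) z = rin x z + rin y z.
Proof. by rewrite /rin innerDl raddfD. Qed.

Lemma rinDr x y z : rin x (y + z) = rin x y + rin x z.
Proof. by rewrite /rin innerDr raddfD. Qed.

Lemma rinBl x y z : rin (x - y) z = rin x z - rin y z.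
Proof. by rewrite /rin innerBl raddfB. Qed.

Lemma rinBr x y z : rin x (y - z) = rin x y - rin x z.
Proof. by rewrite /rin innerBr raddfB. Qed.

Lemma rin0l x : rin 0 x = 0.
Proof. by rewrite -[0 in LHS](subrr x) rinBl subrr. Qed.

Lemma rin0r x : rin x 0 = 0.
Proof. by rewrite rinC rin0l. Qed.

Lemma rinZl (a : R) x y : rin (a%:C%C *: x) y = a * rin x y.
Proof.
by rewrite /rin innerZl; case: (inner x y) => u v /=; rewrite mul0r subr0.
Qed.

Lemma rinZr (a : R) x y : rin x (a%:C%C *: y) = a * rin x y.
Proof. by rewrite rinC rinZl rinC. Qed.

Lemma rin_suml (I : Type) (r : seq I) (P : pred I) (F : I -> H) y :
  rin (\sum_(i <- r | P i) F i) y = \sum_(i <- r | P i) rin (F i) y.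
Proof. by elim/big_rec2: _ => [|i u v _ <-]; rewrite ?rin0l// rinDl. Qed.

Lemma rin_sumr (I : Type) (r : seq I) (P : pred I) (F : I -> H) y :
  rin y (\sum_(i <- r | P i) F i) = \sum_(i <- r | P i) rin y (F i).
Proof. by rewrite rinC rin_suml; apply: eq_bigr => i _; rewrite rinC. Qed.

Lemma rinxx x : rin x x = hnorm x ^+ 2.
Proof. by rewrite /rin -normE hnormE -rmorphXn. Qed.

Lemma hnorm0 : hnorm (0 : H) = 0.
Proof. by rewrite /hnorm normr0. Qed.

Lemma hnorm_eq0 x : hnorm x = 0 -> x = 0.
Proof. by move=> x0; apply/normr0_eq0; rewrite hnormE x0. Qed.

Lemma hnormN x : hnorm (- x) = hnorm x.
Proof. by rewrite /hnorm normrN. Qed.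

Lemma hnormBC x y : hnorm (x - y) = hnorm (y - x).
Proof. by rewrite -hnormN opprB. Qed.

Lemma hnorm_tri z x y : hnorm (x - y) <= hnorm (x - z) + hnorm (z - y).
Proof. by rewrite -{1}[x](subrK z) -addrA ler_hnormD. Qed.

Lemma hnormZE (c : R[i]) x : hnorm (c *: x) = cabs c * hnorm x.
Proof. exact: hnormZ. Qed.

Lemma rin_CS x y : rin x y <= hnorm x * hnorm y.
Proof.
have [x0|x0] := eqVneq (hnorm x) 0.
  by rewrite (hnorm_eq0 x0) rin0l hnorm0 mul0r.
have [y0|y0] := eqVneq (hnorm y) 0.
  by rewrite (hnorm_eq0 y0) rin0r hnorm0 mulr0.
have := sqr_ge0 (hnorm ((hnorm y)%:C%C *: x - (hnorm x)%:C%C *: y)).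
rewrite -rinxx rinBl !rinBr !rinZl !rinZr !rinxx [rin y x]rinC.
have x1 : 0 < hnorm x by rewrite lt0r x0 hnorm_ge0.
have y1 : 0 < hnorm y by rewrite lt0r y0 hnorm_ge0.
set a := hnorm x in x1 *; set b := hnorm y in y1 *; set c := rin x y.
rewrite (_ : _ - _ = 2 * (a * b) * (a * b - c)); last by ring.
by rewrite pmulr_rge0 ?subr_ge0// mulr_gt0// mulr_gt0.
Qed.

Lemma hnorm_complete (u : nat -> H) :
  (forall e, 0 < e -> exists N, forall m n, (N <= m)%N -> (N <= n)%N ->
     hnorm (u m - u n) <= e) ->
  exists l, forall e, 0 < e -> exists N, forall n, (N <= n)%N ->
     hnorm (u n - l) <= e.
Proof.
move=> cu.
have : cauchy (u @ \oo).
  apply/cauchyP => e e0.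
  have eE : e = (Re e)%:C%C by rewrite RRe_real// gtr0_real.
  have e1 : 0 < Re e / 2 by rewrite divr_gt0// -ltcR -eE.
  have [N uN] := cu _ e1.
  exists (u N); exists N => // n /= Nn.
  rewrite -ball_normE /= eE hnormE ltcR (le_lt_trans (uN _ _ _ _))//.
  by rewrite ltr_pdivrMr// ltr_pMr ?ltr1n// -ltcR -eE.
move=> /cauchy_cvg/cvg_ex[l /cvgrPdist_lt ul]; exists l => e e0.
have [|N _ uN] := ul e%:C%C; first by rewrite ltcR.
exists N => n Nn; have := uN n Nn => /=.
by rewrite hnormE ltcR hnormBC => /ltW.
Qed.

End HilbertSpace.

(** * Bounded operators and their norm *)

Section Operators.
Variables (R : realType) (H : hilbertType R).
Implicit Types (S T : 'B(H)) (x y z : H) (c : R[i]).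

Lemma bopDE S T x : (S + T) x = S x + T x. Proof. by []. Qed.
Lemma bopNE T x : (- T) x = - T x. Proof. by []. Qed.
Lemma bopBE S T x : (S - T) x = S x - T x. Proof. by []. Qed.
Lemma bop0E x : (0 : 'B(H)) x = 0. Proof. by []. Qed.
Lemma bop1E x : (1 : 'B(H)) x = x. Proof. by []. Qed.
Lemma bopME S T x : (S * T) x = S (T x). Proof. by []. Qed.
Lemma bopZE c T x : (c *: T) x = c *: T x. Proof. by []. Qed.

Lemma bop_sumE (I : Type) (r : seq I) (P : pred I) (F : I -> 'B(H)) x :
  (\sum_(i <- r | P i) F i) x = \sum_(i <- r | P i) F i x.
Proof. by elim/big_rec2: _ => // i u v _ <-. Qed.

Lemma bop_linear T : linear T.
Proof. by have [] := bop_subproof T. Qed.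

Lemma bopD T x y : T (x + y) = T x + T y.
Proof. by have := bop_linear T 1 x y; rewrite !scale1r. Qed.

Lemma bop0 T : T 0 = 0.
Proof. by apply: (addrI (T 0)); rewrite -bopD !addr0. Qed.

Lemma bopZ T c x : T (c *: x) = c *: T x.
Proof. by have := bop_linear T c x 0; rewrite bop0 !addr0. Qed.

Lemma bop_sum T (I : Type) (r : seq I) (P : pred I) (F : I -> H) :
  T (\sum_(i <- r | P i) F i) = \sum_(i <- r | P i) T (F i).
Proof. by elim/big_rec2: _ => [|i u v _ <-]; rewrite ?bop0 ?bopD. Qed.

Lemma bop_scalel c S T : (c *: S) * T = c *: (S * T).
Proof. exact: bopP. Qed.

Lemma bop_scaler c S T : S * (c *: T) = c *: (S * T).
Proof. by apply: bopP => x; rewrite bopME bopZE bopZ. Qed.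

Lemma bop_of_linear (f : H -> H) (M : R) : linear f ->
  (forall x, hnorm (f x) <= M * hnorm x) -> exists T : 'B(H), T =1 f.
Proof.
move=> lf fM; have fb : f \in @bounded_linear R H.
  by rewrite unfold_in; apply/asboolP; split=> //; exists M.
by exists (Bop fb).
Qed.

Let unit_image T := [set hnorm (T x) | x in [set x | hnorm x <= 1]].

Let unit_image_has_sup T : has_sup (unit_image T).
Proof.
split; first by exists (hnorm (T 0)); exists 0 => //=; rewrite hnorm0.
have [_ [M TM]] := bop_subproof T; exists `|M| => _ [x /= x1 <-].
apply: le_trans (TM x) _; rewrite (le_trans (ler_norm _))// normrM.
by rewrite ler_piMr// ger0_norm// hnorm_ge0.
Qed.

Lemma opnorm_ge0 T : 0 <= opnorm T.
Proof.
apply: (le_trans (hnorm_ge0 (T 0))); apply: ub_le_sup.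
  by have [] := unit_image_has_sup T.
by exists 0 => //=; rewrite hnorm0.
Qed.

Lemma opnormP T x : hnorm (T x) <= opnorm T * hnorm x.
Proof.
have [x0|x0] := eqVneq (hnorm x) 0.
  by rewrite (hnorm_eq0 x0) bop0 !hnorm0 mulr0.
have xp : 0 < hnorm x by rewrite lt0r x0 hnorm_ge0.
rewrite -ler_pdivrMr//; apply: ub_le_sup.
  by have [] := unit_image_has_sup T.
exists ((hnorm x)^-1%:C%C *: x) => /=.
  by rewrite hnormZE cabs_real ger0_norm ?invr_ge0 ?hnorm_ge0// mulVf.
by rewrite bopZ hnormZE cabs_real ger0_norm ?invr_ge0 ?hnorm_ge0// mulrC.
Qed.

Lemma opnorm_le T M : 0 <= M -> (forall x, hnorm (T x) <= M * hnorm x) ->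
  opnorm T <= M.
Proof.
move=> M0 TM; apply: sup_le_ub => [|_ [x /= x1 <-]].
  by have [] := unit_image_has_sup T.
by rewrite (le_trans (TM x))// ler_piMr.
Qed.

Lemma opnorm_gt T r : 0 <= r -> r < opnorm T ->
  exists x, hnorm x <= 1 /\ r < hnorm (T x).
Proof.
move=> r0 rT; apply: contrapT => /forallNP nx.
have : opnorm T <= r.
  apply: sup_le_ub => [|_ [x /= x1 <-]].
    by have [] := unit_image_has_sup T.
  by rewrite leNgt; apply/negP => rx; apply: (nx x).
by rewrite leNgt rT.
Qed.

Lemma opnorm_leM T M x : opnorm T <= M -> hnorm (T x) <= M * hnorm x.
Proof. by move=> TM; rewrite (le_trans (opnormP _ _))// ler_wpM2r// hnorm_ge0. Qed.

Lemma opnormD S T : opnorm (S + T) <= opnorm S + opnorm T.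
Proof.
apply: opnorm_le => [|x]; first by rewrite addr_ge0 ?opnorm_ge0.
by rewrite mulrDl (le_trans (ler_hnormD _ _))// lerD ?opnormP.
Qed.

Lemma opnormM S T : opnorm (S * T) <= opnorm S * opnorm T.
Proof.
apply: opnorm_le => [|x]; first by rewrite mulr_ge0 ?opnorm_ge0.
by rewrite -mulrA bopME (le_trans (opnormP _ _))// ler_wpM2l ?opnorm_ge0 ?opnormP.
Qed.

Lemma opnormM_le S T (a b : R) :
  opnorm S <= a -> opnorm T <= b -> opnorm (S * T) <= a * b.
Proof.
by move=> Sa Tb; rewrite (le_trans (opnormM _ _))// ler_pM ?opnorm_ge0.
Qed.

Lemma opnormZ_le c T : opnorm (c *: T) <= cabs c * opnorm T.
Proof.
apply: opnorm_le => [|x]; first by rewrite mulr_ge0 ?opnorm_ge0 ?cabs_ge0.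
by rewrite bopZE hnormZE -mulrA ler_wpM2l ?cabs_ge0 ?opnormP.
Qed.

Lemma opnorm0 : opnorm (0 : 'B(H)) = 0.
Proof.
apply/le_anti; rewrite opnorm_ge0 andbT; apply: opnorm_le => // x.
by rewrite bop0E hnorm0 mul0r.
Qed.

Lemma opnormZ c T : opnorm (c *: T) = cabs c * opnorm T.
Proof.
apply/le_anti; rewrite opnormZ_le /=.
have [->|c0] := eqVneq c 0; first by rewrite cabs0 mul0r opnorm_ge0.
have := opnormZ_le c^-1 (c *: T).
rewrite scalerA mulVf// scale1r cabsV ler_pdivlMl//.
by rewrite lt0r cabs_eq0 c0 cabs_ge0.
Qed.

Lemma opnormN T : opnorm (- T) = opnorm T.
Proof. by rewrite -scaleN1r opnormZ cabsN cabs1 mul1r. Qed.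

Lemma opnormB S T : opnorm (S - T) <= opnorm S + opnorm T.
Proof. by rewrite (le_trans (opnormD _ _))// opnormN. Qed.

Lemma opnormBC S T : opnorm (S - T) = opnorm (T - S).
Proof. by rewrite -opnormN opprB. Qed.

Lemma opnorm_tri U S T : opnorm (S - T) <= opnorm (S - U) + opnorm (U - T).
Proof. by rewrite -{1}[S](subrK U) -addrA opnormD. Qed.

Lemma opnorm1 : opnorm (1 : 'B(H)) <= 1.
Proof. by apply: opnorm_le => // x; rewrite mul1r. Qed.

Lemma opnorm_sum (I : Type) (r : seq I) (P : pred I) (F : I -> 'B(H)) :
  opnorm (\sum_(i <- r | P i) F i) <= \sum_(i <- r | P i) opnorm (F i).
Proof.
elim/big_rec2: _ => [|i u v _ h]; first by rewrite opnorm0.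
by rewrite (le_trans (opnormD _ _))// lerD2l.
Qed.

Lemma opnorm_le0 T : opnorm T <= 0 -> T = 0.
Proof.
move=> T0; apply: bopP => x; apply: hnorm_eq0; apply/le_anti.
by rewrite hnorm_ge0 andbT (le_trans (opnorm_leM _ T0))// mul0r.
Qed.

(** The limit is taken pointwise in H. That it is linear, and a limit in norm,
    follows from the estimate [close], which is uniform on bounded sets. *)
Lemma opnorm_complete (T : nat -> 'B(H)) :
  (forall e, 0 < e -> exists N, forall m n, (N <= m)%N -> (N <= n)%N ->
     opnorm (T m - T n) <= e) ->
  exists L, forall e, 0 < e -> exists N, forall n, (N <= n)%N ->
     opnorm (T n - L) <= e.
Proof.
move=> cT.
have /choice[f fP] : forall x, exists l, forall e, 0 < e ->
    exists N, forall n, (N <= n)%N -> hnorm (T n x - l) <= e.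
  move=> x; apply: hnorm_complete => e e0.
  have x0 : 0 < hnorm x + 1 by rewrite ltr_wpDl ?hnorm_ge0.
  have [|N TN] := cT (e / (hnorm x + 1)); first by rewrite divr_gt0.
  exists N => m n Nm Nn; rewrite -bopBE.
  rewrite (le_trans (opnorm_leM _ (TN _ _ Nm Nn)))//.
  by rewrite -mulrA ger_pMr// mulrC ler_pdivrMr// mul1r lerDl.
have close e : 0 < e -> exists N, forall n, (N <= n)%N ->
    forall x, hnorm (T n x - f x) <= e * hnorm x.
  move=> e0; have [N TN] := cT _ e0; exists N => n Nn x.
  apply/ler_addgt0Pr => d d0; have [N' fN'] := fP x _ d0.
  pose k := maxn N N'.
  rewrite (le_trans (hnorm_tri (T k x) _ _))// lerD//; last first.
    by rewrite fN'// leq_maxr.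
  by rewrite -bopBE opnorm_leM// TN// leq_maxl.
have lf : linear f.
  move=> c x y; apply/eqP; rewrite -subr_eq0; apply/eqP/hnorm_eq0/le_anti.
  rewrite hnorm_ge0 andbT; apply/ler_addgt0Pr => d d0; rewrite add0r.
  pose K := hnorm (c *: x + y) + cabs c * hnorm x + hnorm y + 1.
  have K0 : 0 < K.
    by rewrite ltr_wpDl// !addr_ge0 ?mulr_ge0 ?cabs_ge0 ?hnorm_ge0.
  have [|N fN] := close (d / K); first by rewrite divr_gt0.
  have -> : f (c *: x + y) - (c *: f x + f y) =
      - (T N (c *: x + y) - f (c *: x + y)) +
      (c *: (T N x - f x) + (T N y - f y)).
    by rewrite bopD bopZ scalerBr opprB (addrACA (c *: T N x)) -opprD addrA subrK.
  rewrite (le_trans (ler_hnormD _ _))// hnormN.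
  rewrite (@le_trans _ _ (d / K * hnorm (c *: x + y) +
     (cabs c * (d / K * hnorm x) + d / K * hnorm y)))//.
    rewrite lerD ?fN// (le_trans (ler_hnormD _ _))// lerD ?fN//.
    by rewrite hnormZE ler_wpM2l ?cabs_ge0 ?fN.
  rewrite mulrCA -!mulrDr -mulrA ger_pMr// mulrC ler_pdivrMr// mul1r /K.
  by rewrite !addrA lerDl.
have [N fN] := close _ ltr01.
have [L LE] : exists L : 'B(H), L =1 f.
  apply: (@bop_of_linear _ (opnorm (T N) + 1)) => // x.
  have -> : f x = T N x - (T N x - f x) by rewrite opprB addrC subrK.
  rewrite (le_trans (ler_hnormD _ _))// hnormN mulrDl lerD ?opnormP//.
  exact: fN.
exists L => e e0; have [N' fN'] := close _ e0; exists N' => n Nn.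
by apply: opnorm_le => [|x]; [exact: ltW|rewrite bopBE LE fN'].
Qed.

End Operators.

(** * Adjoints *)

Section Adjoint.
Variables (R : realType) (H : hilbertType R).
Implicit Types (S T : 'B(H)) (x y z : H) (c : R[i]).

(** The representing vector minimises the strictly convex functional
    [|z|^2 - 2 Re <T z, y>]: minimising sequences are Cauchy by the parallelogram
    law, and stationarity at the minimum is the required identity. *)
Lemma riesz_real T y : exists z, forall x, rin x z = rin (T x) y.
Proof.
pose J z := rin z z - 2 * rin (T z) y.
pose K := opnorm T * hnorm y.
have K0 : 0 <= K by rewrite mulr_ge0 ?opnorm_ge0 ?hnorm_ge0.
have TK z : rin (T z) y <= K * hnorm z.
  rewrite (le_trans (rin_CS _ _))// /K mulrAC ler_wpM2r ?hnorm_ge0//.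
  exact: opnormP.
have Jlb z : - K ^+ 2 <= J z.
  rewrite /J rinxx; have := TK z; have := sqr_ge0 (hnorm z - K).
  by rewrite sqrrB; lra.
have Jinf : has_inf (range J).
  by split; [exists (J 0), 0|exists (- K ^+ 2) => _ [z _ <-]].
pose j := inf (range J).
have jJ z : j <= J z by apply: ge_inf; [case: Jinf|exists z].
have /choice[u uJ] n : exists z, J z < j + n.+1%:R^-1.
  have [|_ [z _ <-] zJ] := @inf_adherent R (range J) n.+1%:R^-1 _ Jinf.
    by rewrite invr_gt0.
  by exists z.
have JE z w : J z + J w - 2 * J ((2^-1)%:C%C *: (z + w)) =
    2^-1 * hnorm (z - w) ^+ 2.
  rewrite /J -rinxx bopZ bopD !(rinZl, rinZr) !(rinBl, rinBr, rinDl, rinDr).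
  by rewrite [rin w z]rinC; field.
have [e e0|l ul] := @hnorm_complete R H u.
  have [|N HN] := @inv_nat_small R (e ^+ 2 / 4); first by rewrite divr_gt0 ?exprn_gt0.
  exists N => m n Nm Nn; rewrite -ler_sqr ?nnegrE ?hnorm_ge0 ?ltW//.
  have := JE (u m) (u n); have := jJ ((2^-1)%:C%C *: (u m + u n)).
  have := uJ m; have := uJ n; have := HN _ Nm; have := HN _ Nn.
  move: (J _) (J _) (J _) (hnorm _) (m.+1%:R^-1) (n.+1%:R^-1) => a b c d p q.
  by clearbody j; lra.
exists l => x; apply/eqP; rewrite -subr_eq0 -normr_le0.
apply/ler_addgt0Pr => e e0; rewrite add0r.
have x1 : 0 < hnorm x + 1 by rewrite ltr_wpDl ?hnorm_ge0.
pose d := e / 2 / (hnorm x + 1).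
have d0 : 0 < d by rewrite !divr_gt0.
have [N1 HN1] := @inv_nat_small R (d ^+ 2) (exprn_gt0 _ d0).
have [N2 HN2] := ul _ d0.
pose n := maxn N1 N2.
have un : hnorm (u n - l) <= d by rewrite HN2// leq_maxr.
pose D := rin (u n) x - rin (T x) y.
have D2 : `|D| <= d * hnorm x.
  have [x0|x0] := eqVneq (hnorm x) 0.
    by rewrite /D (hnorm_eq0 x0) bop0 rin0r rin0l subrr normr0 hnorm0 mulr0.
  have xp : 0 < hnorm x by rewrite lt0r x0 hnorm_ge0.
  rewrite -ler_sqr ?nnegrE ?normr_ge0 ?(mulr_ge0 (ltW d0) (hnorm_ge0 x))//.
  rewrite real_normK ?num_real// exprMn.
  (* The minimum of the quadratic polynomial t |-> J (u n + t x). *)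
  pose t := - D / hnorm x ^+ 2.
  have h2 : 0 < hnorm x ^+ 2 by rewrite exprn_gt0.
  have Jt : J (u n + t%:C%C *: x) = J (u n) - D ^+ 2 / hnorm x ^+ 2.
    rewrite /J bopD bopZ !(rinDl, rinDr, rinZl, rinZr) [rin x (u n)]rinC.
    rewrite (_ : rin (u n) x = D + rin (T x) y); last by rewrite subrK.
    by rewrite [rin x x]rinxx /t; field.
  have := jJ (u n + t%:C%C *: x); rewrite Jt -ler_pdivrMr// => jD.
  have := uJ n; have := HN1 n (leq_maxl _ _).
  move: jD; move: (D ^+ 2 / _) (J _) (n.+1%:R^-1) => p q r.
  by clearbody j; move: (d ^+ 2) => s; lra.
have -> : rin x l - rin (T x) y = D - rin (u n - l) x.
  by rewrite /D rinBl [rin x l]rinC; ring.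
have D3 : `|rin (u n - l) x| <= d * hnorm x.
  rewrite ler_norml; apply/andP; split.
    rewrite lerNl -[- rin _ _](_ : rin (l - u n) x = _); last first.
      by rewrite !rinBl opprB.
    rewrite (le_trans (rin_CS _ _))// ler_wpM2r ?hnorm_ge0//.
    by rewrite hnormBC.
  by rewrite (le_trans (rin_CS _ _))// ler_wpM2r ?hnorm_ge0.
rewrite (le_trans (ler_normB _ _))// (le_trans (lerD D2 D3))//.
have -> : d * hnorm x + d * hnorm x = e * (hnorm x / (hnorm x + 1)).
  by rewrite /d; field; rewrite gt_eqF.
by rewrite ger_pMr// ler_pdivrMr// mul1r lerDl.
Qed.

Lemma inner_rin x y : inner x y = (rin x y +i* rin x ('i%C *: y))%C.
Proof.
rewrite /rin linearZr_LR /=.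
by case: (inner x y) => a b /=; congr (_ +i* _)%C; ring.
Qed.

Lemma rin_inj x y : (forall z, rin z x = rin z y) -> x = y.
Proof.
move=> xy; apply/eqP; rewrite -subr_eq0; apply/eqP/hnorm_eq0.
by apply/eqP; rewrite -sqrf_eq0 -rinxx rinBr xy subrr.
Qed.

Lemma adj_exists T : exists S : 'B(H), forall x y, inner (T x) y = inner x (S y).
Proof.
have /choice[f fP] := riesz_real T.
have fi x y : inner (T x) y = inner x (f y).
  rewrite !inner_rin fP; congr (_ +i* _)%C.
  have -> : rin (T x) ('i%C *: y) = rin (T (- 'i%C *: x)) y.
    rewrite /rin bopZ innerZl linearZr_LR /=; case: (inner _ _) => a b /=.
    by ring.
  rewrite -fP /rin innerZl linearZr_LR /=; case: (inner _ _) => a b /=.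
  by ring.
have lf : linear f.
  move=> c x y; apply: rin_inj => z; rewrite /rin innerDr linearZr_LR /=.
  by rewrite -!fi innerDr linearZr_LR.
have [S SE] : exists S : 'B(H), S =1 f.
  apply: (@bop_of_linear _ _ _ (opnorm T)) => // y.
  have [f0|f0] := eqVneq (hnorm (f y)) 0.
    by rewrite f0 mulr_ge0 ?opnorm_ge0 ?hnorm_ge0.
  have fp : 0 < hnorm (f y) by rewrite lt0r f0 hnorm_ge0.
  rewrite -(ler_pM2l fp) -expr2 -rinxx fP (le_trans (rin_CS _ _))//.
  by rewrite mulrA ler_wpM2r ?hnorm_ge0// mulrC opnormP.
by exists S => x y; rewrite SE.
Qed.

Lemma adjP T x y : inner (T x) y = inner x (adj T y).
Proof.
rewrite /adj; case: xgetP => [S _ ->|noS]; first exact.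
by have [S ST] := adj_exists T; case: (noS S).
Qed.

Lemma rin_adj T x y : rin (T x) y = rin x (adj T y).
Proof. by rewrite /rin adjP. Qed.

Lemma rin_adjl T x y : rin (adj T x) y = rin x (T y).
Proof. by rewrite rinC -rin_adj rinC. Qed.

Lemma adj_unique S T : (forall x y, rin (T x) y = rin x (S y)) -> adj T = S.
Proof. by move=> TS; apply: bopP => y; apply: rin_inj => x; rewrite -rin_adj. Qed.

Lemma adjK T : adj (adj T) = T.
Proof. by apply: adj_unique => x y; rewrite rin_adjl. Qed.

Lemma adjD S T : adj (S + T) = adj S + adj T.
Proof.
by apply: adj_unique => x y; rewrite !bopDE rinDl rinDr !rin_adj.
Qed.

Lemma adjM S T : adj (S * T) = adj T * adj S.
Proof. by apply: adj_unique => x y; rewrite !bopME !rin_adj. Qed.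

Lemma adjZ c T : adj (c *: T) = c^* *: adj T.
Proof.
apply: adj_unique => x y; rewrite /rin !bopZE innerZl linearZr_LR /= adjP.
by rewrite conjCK.
Qed.

Lemma adj1 : adj (1 : 'B(H)) = 1.
Proof. by apply: adj_unique. Qed.

Lemma adjN T : adj (- T) = - adj T.
Proof. by rewrite -scaleN1r adjZ rmorphN rmorph1 scaleN1r. Qed.

Lemma adjB S T : adj (S - T) = adj S - adj T.
Proof. by rewrite adjD adjN. Qed.

Lemma adj0 : adj (0 : 'B(H)) = 0.
Proof. by rewrite -(subrr 1) adjB !subrr. Qed.

Lemma adj_sum (I : Type) (r : seq I) (P : pred I) (F : I -> 'B(H)) :
  adj (\sum_(i <- r | P i) F i) = \sum_(i <- r | P i) adj (F i).
Proof. by elim/big_rec2: _ => [|i u v _ <-]; rewrite ?adj0 ?adjD. Qed.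

Lemma opnorm_adj_le T : opnorm (adj T) <= opnorm T.
Proof.
apply: opnorm_le => [|x]; first exact: opnorm_ge0.
have [f0|f0] := eqVneq (hnorm (adj T x)) 0.
  by rewrite f0 mulr_ge0 ?opnorm_ge0 ?hnorm_ge0.
have fp : 0 < hnorm (adj T x) by rewrite lt0r f0 hnorm_ge0.
rewrite -(ler_pM2l fp) -expr2 -rinxx -rin_adj (le_trans (rin_CS _ _))//.
by rewrite mulrA ler_wpM2r ?hnorm_ge0// mulrC opnormP.
Qed.

Lemma opnorm_adj T : opnorm (adj T) = opnorm T.
Proof. by apply/le_anti; rewrite opnorm_adj_le -{1}[T]adjK opnorm_adj_le. Qed.

Lemma hnorm_adjM T x : hnorm (T x) ^+ 2 = rin ((adj T * T) x) x.
Proof. by rewrite bopME rin_adjl rinxx. Qed.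

(** The nontrivial inequality is [|T x|^2 = <T* T x, x> <= |T* T| |x|^2]. *)
Lemma cstar_identity T : opnorm (adj T * T) = opnorm T ^+ 2.
Proof.
apply/le_anti/andP; split.
  by rewrite (le_trans (opnormM _ _))// opnorm_adj -expr2.
have sq := sqrtr_ge0 (opnorm (adj T * T)).
rewrite -[leRHS]sqr_sqrtr ?opnorm_ge0// ler_sqr ?nnegrE ?opnorm_ge0//.
apply: opnorm_le => // x.
rewrite -ler_sqr ?nnegrE ?mulr_ge0 ?hnorm_ge0// exprMn sqr_sqrtr ?opnorm_ge0//.
rewrite hnorm_adjM (le_trans (rin_CS _ _))// expr2 mulrA.
by rewrite ler_wpM2r ?hnorm_ge0// opnormP.
Qed.

Lemma unitary_hnorm T x : unitary_op T -> hnorm (T x) = hnorm x.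
Proof.
move=> [TT _]; apply/eqP; rewrite -(@eqrXn2 _ 2) ?hnorm_ge0//.
by rewrite hnorm_adjM TT -rinxx.
Qed.

Lemma unitary_opnorm T : unitary_op T -> opnorm T <= 1.
Proof. by move=> uT; apply: opnorm_le => // x; rewrite unitary_hnorm// mul1r. Qed.

Definition selfadj T := adj T = T.

(** Polarisation, which needs complex scalars: a rotation of a real plane
    satisfies [<D x, x> = 0] without vanishing. *)
Lemma quadratic_form0 (D : 'B(H)) : (forall x, inner (D x) x = 0) -> D = 0.
Proof.
move=> D0.
have D1 x y : inner (D x) y + inner (D y) x = 0.
  have := D0 (x + y); rewrite bopD !innerDl !innerDr !D0 add0r addr0.
  by rewrite addrC.
have D2 x y : inner (D x) y = 0.
  have := D1 x y; have := D1 x ('i%C *: y).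
  rewrite bopZ innerZl linearZr_LR /=.
  set a := inner _ _; set b := inner _ _ => + ab.
  have -> : b = - a by apply/eqP; rewrite -addr_eq0 addrC ab.
  case: a {ab} => p q /=; rewrite /GRing.add /= => -[].
  by move=> ? ?; congr (_ +i* _)%C; lra.
by apply/bopP => x; apply: rin_inj => z; rewrite bop0E rin0r rinC /rin D2.
Qed.

Lemma positive_selfadj T : positive_op T -> selfadj T.
Proof.
move=> Tpos.
have real x : inner (T x) x = inner (adj T x) x.
  rewrite [RHS]innerC -adjP; have := Tpos x; case: (inner _ _) => a b.
  by rewrite lecE /= => /andP[/eqP-> _]; congr (_ +i* _)%C; rewrite oppr0.
apply/esym/eqP; rewrite -subr_eq0; apply/eqP/quadratic_form0 => x.
by rewrite bopBE innerBl real subrr.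
Qed.

End Adjoint.

(** * C*-subalgebras: Neumann series and square roots *)

Section CstarAlgebra.
Variables (R : realType) (H : hilbertType R) (A : set 'B(H)).
Hypothesis hA : cstar_subalgebra A.
Implicit Types (a b : 'B(H)) (c : R[i]).

Lemma cstar_one : A 1. Proof. by have [[]] := hA. Qed.
Lemma cstarD a b : A a -> A b -> A (a + b).
Proof. by have [[_ h] _ _ _ _] := hA; exact: h. Qed.
Lemma cstarZ c a : A a -> A (c *: a).
Proof. by have [_ h _ _ _] := hA; exact: h. Qed.
Lemma cstarM a b : A a -> A b -> A (a * b).
Proof. by have [_ _ h _ _] := hA; exact: h. Qed.
Lemma cstar_adj a : A a -> A (adj a).
Proof. by have [_ _ _ h _] := hA; exact: h. Qed.
Lemma cstar_zero : A 0.
Proof. by have := cstarZ 0 cstar_one; rewrite scale0r. Qed.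
Lemma cstarN a : A a -> A (- a).
Proof. by move=> Aa; rewrite -scaleN1r; exact: cstarZ. Qed.
Lemma cstarB a b : A a -> A b -> A (a - b).
Proof. by move=> Aa Ab; apply: cstarD => //; exact: cstarN. Qed.

Lemma cstar_sum (I : Type) (r : seq I) (P : pred I) (F : I -> 'B(H)) :
  (forall i, P i -> A (F i)) -> A (\sum_(i <- r | P i) F i).
Proof.
move=> AF; elim/big_rec: _ => [|i u Pi Au]; first exact: cstar_zero.
by apply: cstarD => //; exact: AF.
Qed.

Lemma cstar_sum_seq (I : eqType) (r : seq I) (F : I -> 'B(H)) :
  (forall i, i \in r -> A (F i)) -> A (\sum_(i <- r) F i).
Proof. by move=> AF; rewrite big_seq; apply: cstar_sum => i; exact: AF. Qed.

Lemma cstar_closed T :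
  (forall e, 0 < e -> exists2 a, A a & opnorm (T - a) <= e) -> A T.
Proof.
move=> AT; have [_ _ _ _ h] := hA; apply: h => e e0.
have [|a Aa Ta] := AT (e / 2); first by rewrite divr_gt0.
by exists a => //; rewrite (le_lt_trans Ta)// ltr_pdivrMr// ltr_pMr// ltr1n.
Qed.

End CstarAlgebra.

Lemma opnorm_small (R : realType) (H : hilbertType R) (T : 'B(H)) (k : R) :
  (forall e, 0 < e -> opnorm T <= k * e) -> T = 0.
Proof.
move=> Tk; apply: opnorm_le0; apply/ler_addgt0Pr => e e0; rewrite add0r.
have k0 : 0 < `|k| + 1 by rewrite ltr_wpDl.
rewrite (le_trans (Tk (e / (`|k| + 1)) _)) ?divr_gt0//.
rewrite mulrCA ger_pMr// ler_pdivrMr// mul1r.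
by rewrite (le_trans (ler_norm k))// lerDl.
Qed.

Section Convergence.
Variables (R : realType) (H : hilbertType R) (A : set 'B(H)).
Hypothesis hA : cstar_subalgebra A.

(** The majorant method: increments telescope, and t is Cauchy because it is
    increasing and bounded. *)
Lemma cstar_majorant (u : nat -> 'B(H)) (t : nat -> R) (M : R) :
  (forall n, A (u n)) -> (forall n, opnorm (u n.+1 - u n) <= t n.+1 - t n) ->
  (forall n, t n <= M) ->
  exists2 L, A L &
    forall e, 0 < e -> exists N, forall n, (N <= n)%N -> opnorm (u n - L) <= e.
Proof.
move=> Au ut tM.
have ut2 n k : opnorm (u (n + k)%N - u n) <= t (n + k)%N - t n.
  elim: k => [|k IH]; first by rewrite addn0 !subrr opnorm0.
  rewrite addnS (le_trans (opnorm_tri (u (n + k)%N) _ _))//.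
  by rewrite (le_trans (lerD (ut _) IH))// addrA subrK.
have tsup : has_sup (range t).
  by split; [exists (t 0%N), 0%N|exists M => _ [n _ <-]].
have [e e0|L uL] := @opnorm_complete R H u; last first.
  exists L => //; apply: (cstar_closed hA) => e /uL[N HN].
  by exists (u N) => //; rewrite opnormBC HN.
have [_ [N _ <-] tN] := sup_adherent e0 tsup.
have HN m n : (N <= n)%N -> (n <= m)%N -> opnorm (u m - u n) <= e.
  move=> Nn /subnKC <-; rewrite (le_trans (ut2 _ _))//.
  have t1 : t (n + (m - n))%N <= sup (range t).
    by apply: ub_le_sup; [case: tsup|exists (n + (m - n))%N].
  have t2 : t N <= t n.
    rewrite -subr_ge0 -(subnKC Nn) (le_trans _ (ut2 _ _))//.
    exact: opnorm_ge0.
  by move: t1 t2 tN; set s := sup _; lra.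
exists N => m n Nm Nn; case: (leqP n m) => [nm|/ltnW mn]; first exact: HN.
by rewrite opnormBC HN.
Qed.

Lemma neumann a : A a -> opnorm a < 1 -> exists2 b, A b & b * (1 - a) = 1.
Proof.
move=> Aa a1; have a0 := opnorm_ge0 a.
pose u n : 'B(H) := \sum_(0 <= k < n) a ^+ k.
pose t n : R := \sum_(0 <= k < n) opnorm a ^+ k.
have AX k : A (a ^+ k).
  elim: k => [|k IH]; first by rewrite expr0; exact: (cstar_one hA).
  by rewrite exprS; apply: (cstarM hA).
have aX k : opnorm (a ^+ k) <= opnorm a ^+ k.
  elim: k => [|k IH]; first by rewrite !expr0 opnorm1.
  by rewrite !exprS opnormM_le.
have uE n : u n * (1 - a) = 1 - a ^+ n.
  rewrite /u; elim: n => [|n IH].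
    by rewrite big_geq// mul0r expr0 subrr.
  by rewrite big_nat_recr//= mulrDl IH mulrBr mulr1 exprSr addrA subrK.
have tE n : t n * (1 - opnorm a) = 1 - opnorm a ^+ n.
  rewrite /t; elim: n => [|n IH].
    by rewrite big_geq// mul0r expr0 subrr.
  by rewrite big_nat_recr//= mulrDl IH mulrBr mulr1 exprSr addrA subrK.
have a1' : 0 < 1 - opnorm a by rewrite subr_gt0.
have [||n|b Ab ub] := @cstar_majorant u t (1 - opnorm a)^-1.
- by move=> n; apply: (cstar_sum hA) => k _; exact: AX.
- move=> n; rewrite /u /t !big_nat_recr//= [X in X - _]addrC addrK.
  by rewrite [X in X - _]addrC addrK.
- by rewrite -[leRHS]mul1r ler_pdivlMr// tE lerBlDr lerDl exprn_ge0.
exists b => //.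
have aE e : 0 < e -> exists N, forall n, (N <= n)%N -> opnorm a ^+ n <= e.
  have aa : `|opnorm a| < 1 by rewrite ger0_norm.
  move=> e0; have /cvgrPdist_lt/(_ _ e0)[N _ HN] := cvg_expr aa.
  exists N => n /HN /=.
  by rewrite sub0r normrN ger0_norm ?exprn_ge0// => /ltW.
apply/eqP; rewrite -subr_eq0; apply/eqP.
apply: (@opnorm_small _ _ _ (opnorm (1 - a) + 1)) => e e0.
have [N1 HN1] := ub _ e0; have [N2 HN2] := aE _ e0.
pose n := maxn N1 N2.
have -> : b * (1 - a) - 1 = - ((u n - b) * (1 - a)) - a ^+ n.
  by rewrite mulrBl uE opprB -addrA; congr (_ + _); rewrite -opprD subrK.
rewrite (le_trans (opnormB _ _))// opnormN [leRHS]mulrDl mul1r lerD//.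
  by rewrite (le_trans (opnormM _ _))// mulrC ler_wpM2l ?opnorm_ge0// HN1// leq_maxl.
by rewrite (le_trans (aX _))// HN2// leq_maxr.
Qed.

Hypothesis hcomm : forall a b, A a -> A b -> a * b = b * a.

(** The iteration [y -> (x + y^2) / 2] converges to [1 - sqrt (1 - x)], and its
    scalar version with [x = 1] is a majorant. *)
Lemma cstar_sqrt x : A x -> selfadj x -> opnorm x <= 1 ->
  exists s, [/\ A s, selfadj s & s * s = 1 - x].
Proof.
move=> Ax sx x1.
pose h : R[i] := (2^-1)%:C%C.
have hE : h + h = 1.
  by rewrite /h -rmorphD /= -[RHS](rmorph1 (real_complex R)) /=; congr (_%:C%C); field.
have ch : cabs h = 2^-1 by rewrite cabs_real ger0_norm.
pose y := fix y n := if n is m.+1 then h *: (x + y m * y m) else 0.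
pose t := fix t n : R := if n is m.+1 then (1 + t m * t m) / 2 else 0.
have Ay n : A (y n).
  elim: n => [|n IH] /=; first exact: (cstar_zero hA).
  by apply/(cstarZ hA)/(cstarD hA) => //; exact: (cstarM hA).
have sy n : selfadj (y n).
  rewrite /selfadj; elim: n => [|n IH] /=; first exact: adj0.
  by rewrite adjZ adjD adjM IH sx /h /=; congr (_ *: _); rewrite /Num.conj /= oppr0.
have t01 n : 0 <= t n <= 1.
  elim: n => [|n /andP[IH1 IH2]] /=; first by rewrite lexx ler01.
  have : t n * t n <= 1 by rewrite mulr_ile1.
  have : 0 <= t n * t n by rewrite mulr_ge0.
  by move=> *; apply/andP; split; lra.
have yt n : opnorm (y n) <= t n.
  elim: n => [|n IH] /=; first by rewrite opnorm0.
  rewrite opnormZ ch mulrC ler_wpM2r//.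
  by rewrite (le_trans (opnormD _ _))// lerD// opnormM_le.
have dE (a b : 'B(H)) : A a -> A b -> a * a - b * b = (a - b) * (a + b).
  move=> Aa Ab; rewrite mulrDr !mulrBl (hcomm Ab Aa) addrA.
  by rewrite subrK.
have ydt n : opnorm (y n.+1 - y n) <= t n.+1 - t n.
  elim: n => [|n IH]; first by rewrite !subr0 yt.
  have -> : y n.+2 - y n.+1 = h *: ((y n.+1 - y n) * (y n.+1 + y n)).
    rewrite -dE; [|exact: Ay|exact: Ay].
    rewrite [y n.+2]/= [X in _ - X]/= -scalerBr; congr (_ *: _).
    by rewrite opprD addrACA subrr add0r.
  have -> : t n.+2 - t n.+1 = 2^-1 * ((t n.+1 - t n) * (t n.+1 + t n)).
    have tS m : t m.+1 = (1 + t m * t m) / 2 by [].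
    by rewrite (tS n.+1) [X in _ - X = _]tS; move: (t n.+1) (t n) => *; field.
  rewrite opnormZ ch ler_wpM2l// opnormM_le//.
  by rewrite (le_trans (opnormD _ _))// lerD// yt.
have [|l Al yl] := @cstar_majorant y t 1 Ay ydt.
  by move=> n; have /andP[] := t01 n.
have lE : l = h *: (x + l * l).
  apply/eqP; rewrite -subr_eq0; apply/eqP.
  apply: (@opnorm_small _ _ _ (1 + 2^-1 * (1 + opnorm l))) => e e0.
  have [N HN] := yl _ e0.
  have -> : l - h *: (x + l * l) =
      - (y N.+1 - l) + h *: ((y N - l) * (y N + l)).
    rewrite -dE// opprB -addrA; congr (_ + _).
    rewrite [y N.+1]/= [RHS]addrC -scalerBr -scalerN; congr (_ *: _).
    by rewrite [in RHS]opprD [- x - _]addrC addrACA subrr add0r opprD addrC.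
  rewrite (le_trans (opnormD _ _))// opnormN [leRHS]mulrDl mul1r lerD ?HN//.
  rewrite opnormZ ch -mulrA ler_wpM2l// mulrC opnormM_le ?HN//.
  rewrite (le_trans (opnormD _ _))// lerD2r (le_trans (yt _))//.
  by have /andP[] := t01 N.
have sl : selfadj l.
  apply/eqP; rewrite -subr_eq0; apply/eqP.
  apply: (@opnorm_small _ _ _ 2) => e e0; have [N HN] := yl _ e0.
  rewrite (le_trans (opnorm_tri (y N) _ _))// mulrDl mul1r lerD ?HN//.
  by rewrite -{1}[y N]sy -adjB opnorm_adj opnormBC HN.
exists (1 - l); split.
- by apply: (cstarB hA) => //; exact: (cstar_one hA).
- by rewrite /selfadj adjB adj1 sl.
have l2 : l + l = x + l * l by rewrite {1 2}lE -scalerDl hE scale1r.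
rewrite mulrBr mulr1 mulrBl mul1r opprB addrACA -opprD l2.
by rewrite opprD addrACA subrr addr0.
Qed.

End Convergence.

(** * Star morphisms and characters *)

Section StarMorphism.
Variables (R : realType) (H K : hilbertType R) (A : set 'B(H)).
Variable pi : 'B(H) -> 'B(K).
Hypothesis hA : cstar_subalgebra A.
Hypothesis hcomm : forall a b, A a -> A b -> a * b = b * a.
Hypothesis hpi : star_morphism A pi.

Lemma morD a b : A a -> A b -> pi (a + b) = pi a + pi b.
Proof. by have [h _ _ _] := hpi; exact: h. Qed.
Lemma morZ (c : R[i]) a : A a -> pi (c *: a) = c *: pi a.
Proof. by have [_ h _ _] := hpi; exact: h. Qed.
Lemma morM a b : A a -> A b -> pi (a * b) = pi a * pi b.
Proof. by have [_ _ h _] := hpi; exact: h. Qed.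
Lemma mor_adj a : A a -> pi (adj a) = adj (pi a).
Proof. by have [_ _ _ h] := hpi; exact: h. Qed.
Lemma mor0 : pi 0 = 0.
Proof. by have := morZ 0 (cstar_zero hA); rewrite !scale0r. Qed.
Lemma morB a b : A a -> A b -> pi (a - b) = pi a - pi b.
Proof.
by move=> Aa Ab; rewrite -scaleN1r morD ?morZ ?scaleN1r//; exact: (cstarN hA).
Qed.

Lemma mor_sum (I : eqType) (r : seq I) (F : I -> 'B(H)) :
  (forall i, i \in r -> A (F i)) ->
  pi (\sum_(i <- r) F i) = \sum_(i <- r) pi (F i).
Proof.
elim: r => [|i r IH] AF; first by rewrite !big_nil mor0.
rewrite !big_cons morD ?IH//.
- by move=> j jr; apply: AF; rewrite inE jr orbT.
- by apply: AF; rewrite inE eqxx.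
- by apply: (cstar_sum_seq hA) => j jr; apply: AF; rewrite inE jr orbT.
Qed.

Hypothesis pi1 : pi 1 = 1.

(** If [|b| <= 1] then [1 - b* b] is a square s s with s selfadjoint, so that
    [|v|^2 - |pi b v|^2 = |pi s v|^2] is nonnegative. *)
Lemma mor_contractive a : A a -> opnorm (pi a) <= opnorm a.
Proof.
move=> Aa; have [a0|a0] := eqVneq (opnorm a) 0.
  by rewrite (opnorm_le0 (_ : opnorm a <= 0)) ?a0// mor0 !opnorm0.
have ap : 0 < opnorm a by rewrite lt0r a0 opnorm_ge0.
pose b := (opnorm a)^-1%:C%C *: a.
have Ab : A b by exact: (cstarZ hA).
have Ab2 : A (adj b * b) by apply: (cstarM hA) => //; exact: (cstar_adj hA).
have b1 : opnorm b = 1.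
  by rewrite opnormZ cabs_real ger0_norm ?invr_ge0 ?opnorm_ge0// mulVf.
have [||s [As ss s2]] := cstar_sqrt hA hcomm Ab2.
- by rewrite /selfadj adjM adjK.
- by rewrite cstar_identity b1 expr1n.
have pib v : hnorm (pi b v) <= hnorm v.
  rewrite -ler_sqr ?nnegrE ?hnorm_ge0// -subr_ge0 -rinxx hnorm_adjM.
  rewrite -mor_adj// -morM//; last exact: (cstar_adj hA).
  rewrite -[X in rin X v - _]bop1E -pi1 -rinBl -bopBE -morB//; last first.
    exact: (cstar_one hA).
  by rewrite -s2 morM// bopME -{1}ss mor_adj// rin_adjl rinxx sqr_ge0.
have -> : a = (opnorm a)%:C%C *: b.
  by rewrite scalerA -rmorphM /= mulfV// rmorph1 scale1r.
rewrite morZ// opnormZ [leRHS]opnormZ ler_wpM2l ?cabs_ge0// b1.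
by apply: opnorm_le => // v; rewrite mul1r.
Qed.

End StarMorphism.

Section Character.
Variables (R : realType) (H : hilbertType R) (A : set 'B(H)).
Hypothesis hA : cstar_subalgebra A.
Implicit Types chi : character A.

Lemma char1 chi : chi 1 = 1. Proof. by have [] := char_funP chi. Qed.
Lemma charD chi a b : A a -> A b -> chi (a + b) = chi a + chi b.
Proof. by have [_ h _ _ _] := char_funP chi; exact: h. Qed.
Lemma charZ chi (c : R[i]) a : A a -> chi (c *: a) = c * chi a.
Proof. by have [_ _ h _ _] := char_funP chi; exact: h. Qed.
Lemma charM chi a b : A a -> A b -> chi (a * b) = chi a * chi b.
Proof. by have [_ _ _ h _] := char_funP chi; exact: h. Qed.
Lemma charB chi a b : A a -> A b -> chi (a - b) = chi a - chi b.
Proof.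
move=> Aa Ab; rewrite -scaleN1r charD//; last exact: (cstarZ hA).
by rewrite charZ// mulN1r.
Qed.

Lemma char_ext chi chi' : (forall a, A a -> chi a = chi' a) -> chi = chi'.
Proof.
move=> E; have {}E : char_fun chi = char_fun chi'.
  apply: funext => T; have [/E//|nAT] := pselect (A T).
  have [_ _ _ _ ->//] := char_funP chi; have [_ _ _ _ ->//] := char_funP chi'.
by case: chi chi' E => f fP [g gP] /= E; case: g / E gP => gP;
  congr Character; exact: Prop_irrelevance.
Qed.

(** If [|a| < |chi a|], then [1 - a / chi a] is invertible by the Neumann series,
    although chi annihilates it. *)
Lemma char_le chi a : A a -> cabs (chi a) <= opnorm a.
Proof.
move=> Aa; rewrite leNgt; apply/negP => ac.
have c0 : chi a != 0.
  by rewrite -cabs_eq0 gt_eqF// (le_lt_trans (opnorm_ge0 a)).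
pose b := (chi a)^-1 *: a; have Ab : A b by exact: (cstarZ hA).
have A1 := cstar_one hA.
have [|d Ad db] := neumann hA Ab.
  by rewrite opnormZ cabsV mulrC ltr_pdivrMr ?mul1r// lt0r cabs_eq0 c0 cabs_ge0.
have : chi (d * (1 - b)) = 0.
  rewrite charM//; last exact: (cstarB hA).
  by rewrite charB// char1 charZ// mulVf// subrr mulr0.
by rewrite db char1 => /eqP; rewrite oner_eq0.
Qed.

End Character.

(** * Orderings of the selfadjoint part of a commutative C*-algebra *)

Section Gelfand.
Variables (R : realType) (H : hilbertType R) (A : set 'B(H)).
Hypothesis hA : cstar_subalgebra A.
Hypothesis hcomm : forall a b, A a -> A b -> a * b = b * a.
Implicit Types (a b c : 'B(H)) (Q : set 'B(H)) (r s t e : R).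

(** The selfadjoint elements of A, a commutative real algebra. *)
Definition sa a := A a /\ selfadj a.
Definition scalar_op r : 'B(H) := r%:C%C *: (1 : 'B(H)).

Lemma scalar_opD r s : scalar_op (r + s) = scalar_op r + scalar_op s.
Proof. by rewrite /scalar_op rmorphD scalerDl. Qed.
Lemma scalar_opN r : scalar_op (- r) = - scalar_op r.
Proof. by rewrite /scalar_op rmorphN scaleNr. Qed.
Lemma scalar_opB r s : scalar_op (r - s) = scalar_op r - scalar_op s.
Proof. by rewrite scalar_opD scalar_opN. Qed.
Lemma scalar_op0 : scalar_op 0 = 0.
Proof. by rewrite /scalar_op rmorph0 scale0r. Qed.
Lemma scalar_op1 : scalar_op 1 = 1.
Proof. by rewrite /scalar_op rmorph1 scale1r. Qed.
Lemma scalar_opMl r a : scalar_op r * a = r%:C%C *: a.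
Proof. by rewrite /scalar_op bop_scalel mul1r. Qed.
Lemma scalar_opMr r a : a * scalar_op r = r%:C%C *: a.
Proof. by rewrite /scalar_op bop_scaler mulr1. Qed.
Lemma scalar_opM r s : scalar_op (r * s) = scalar_op r * scalar_op s.
Proof. by rewrite scalar_opMl /scalar_op scalerA -rmorphM. Qed.

Lemma sa_scalar_op r : sa (scalar_op r).
Proof.
split; first by apply: (cstarZ hA); exact: (cstar_one hA).
by rewrite /selfadj /scalar_op adjZ adj1; congr (_ *: _); rewrite /Num.conj /= oppr0.
Qed.
Lemma sa0 : sa 0. Proof. by rewrite -scalar_op0; exact: sa_scalar_op. Qed.
Lemma sa1 : sa 1. Proof. by rewrite -scalar_op1; exact: sa_scalar_op. Qed.
Lemma saD a b : sa a -> sa b -> sa (a + b).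
Proof.
by move=> [Aa sa] [Ab sb]; split; [exact: (cstarD hA)|rewrite /selfadj adjD sa sb].
Qed.
Lemma saN a : sa a -> sa (- a).
Proof. by move=> [Aa sa]; split; [exact: (cstarN hA)|rewrite /selfadj adjN sa]. Qed.
Lemma saB a b : sa a -> sa b -> sa (a - b).
Proof. by move=> sa /saN sb; exact: saD. Qed.
Lemma saM a b : sa a -> sa b -> sa (a * b).
Proof.
move=> [Aa sa] [Ab sb]; split; first exact: (cstarM hA).
by rewrite /selfadj adjM sa sb hcomm.
Qed.
Lemma saZ r a : sa a -> sa (r%:C%C *: a).
Proof. by rewrite -scalar_opMl; apply: saM; exact: sa_scalar_op. Qed.

(** The preorderings of real algebra. A maximal one that does not contain -1 turns
    out to be the set of selfadjoint elements on which some character is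
    nonnegative; characters are obtained in this way, without the Gelfand-Mazur
    theorem. *)
Definition preordering Q :=
  [/\ Q `<=` sa, forall a, sa a -> Q (a * a),
      forall a b, Q a -> Q b -> Q (a + b) & forall a b, Q a -> Q b -> Q (a * b)].

(** Sums of squares: the least preordering. *)
Inductive sos : 'B(H) -> Prop :=
| sos_sqr a : sa a -> sos (a * a)
| sos_add a b : sos a -> sos b -> sos (a + b).

Lemma sqrM_comm a b : sa a -> sa b -> (a * a) * (b * b) = (a * b) * (a * b).
Proof.
move=> [Aa _] [Ab _].
by rewrite -!mulrA; congr (_ * _); rewrite !mulrA (hcomm Aa Ab).
Qed.

Lemma sos_ge0 a x : sos a -> 0 <= rin (a x) x.
Proof.
elim=> [s [_ ss]|{}a b _ a0 _ b0]; last by rewrite bopDE rinDl addr_ge0.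
by rewrite -{1}ss bopME rin_adjl rinxx sqr_ge0.
Qed.

Lemma sos_preordering : preordering sos.
Proof.
split=> [a|s|a b|a b]; [|exact: sos_sqr|exact: sos_add|].
  by elim=> [s ss|{}a b _ sA _ sB]; [exact: saM|exact: saD].
elim=> [s ss|{}a c _ IHa _ IHc sb]; last first.
  by rewrite mulrDl; apply: sos_add; [exact: IHa|exact: IHc].
elim=> [t st|{}b c _ IHb _ IHc]; last by rewrite mulrDr; exact: sos_add.
by rewrite sqrM_comm//; apply: sos_sqr; exact: saM.
Qed.

(** The least preordering containing Q and b: even powers of b are squares, so
    terms of degree at most one suffice. *)
Definition adjoin Q b : set 'B(H) :=
  [set q | exists q1 q2, [/\ Q q1, Q q2 & q = q1 + q2 * b]].

Lemma preordering0 Q : preordering Q -> Q 0.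
Proof. by move=> [_ h _ _]; rewrite -(mulr0 0); apply: h; exact: sa0. Qed.

Lemma preordering1 Q : preordering Q -> Q 1.
Proof. by move=> [_ h _ _]; rewrite -(mulr1 1); apply: h; exact: sa1. Qed.

Lemma adjoin_sub Q b : preordering Q -> Q `<=` adjoin Q b.
Proof.
move=> pQ q Qq; exists q, 0; split=> //; first exact: preordering0.
by rewrite mul0r addr0.
Qed.

Lemma adjoin_mem Q b : preordering Q -> adjoin Q b b.
Proof.
move=> pQ; exists 0, 1; split; [exact: preordering0|exact: preordering1|].
by rewrite mul1r add0r.
Qed.

Lemma adjoin_preordering Q b : preordering Q -> sa b -> preordering (adjoin Q b).
Proof.
move=> pQ sb; have [Qsa Qsqr QD QM] := pQ.
split=> [_ [q1 [q2 [Q1 Q2 ->]]]|s ss||].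
- by apply: saD; [exact: Qsa|apply: saM => //; exact: Qsa].
- by apply: adjoin_sub => //; exact: Qsqr.
- move=> _ _ [q1 [q2 [Q1 Q2 ->]]] [q3 [q4 [Q3 Q4 ->]]].
  exists (q1 + q3), (q2 + q4); split; [exact: QD|exact: QD|].
  by rewrite mulrDl addrACA.
- move=> _ _ [q1 [q2 [Q1 Q2 ->]]] [q3 [q4 [Q3 Q4 ->]]].
  exists (q1 * q3 + q2 * q4 * (b * b)), (q1 * q4 + q2 * q3); split.
  + by apply: (QD); [exact: QM|apply: (QM); [exact: QM|exact: Qsqr]].
  + by apply: (QD); exact: QM.
  + have [Ab _] := sb; have [A4 _] := Qsa _ Q4; have [A3 _] := Qsa _ Q3.
    have E1 : q2 * b * q3 = q2 * q3 * b by rewrite -mulrA (hcomm Ab A3) mulrA.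
    have E2 : q2 * b * (q4 * b) = q2 * q4 * (b * b).
      by rewrite -!mulrA; congr (_ * _); rewrite !mulrA (hcomm Ab A4).
    rewrite [LHS]mulrDl !mulrDr E1 E2 [in RHS]mulrDl (mulrA q1).
    by rewrite [q2 * q3 * b + _]addrC addrACA.
Qed.

Section Maximal.
Variable Q : set 'B(H).
Hypothesis pQ : preordering Q.
Hypothesis Q1 : ~ Q (- 1).
Hypothesis Qmax : forall Q', preordering Q' -> Q `<=` Q' -> ~ Q' (- 1) -> Q' `<=` Q.

Let Qsa : Q `<=` sa. Proof. by have [] := pQ. Qed.
Let Qsqr a : sa a -> Q (a * a). Proof. by have [_ h _ _] := pQ; exact: h. Qed.
Let QD a b : Q a -> Q b -> Q (a + b). Proof. by have [_ _ h _] := pQ; exact: h. Qed.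
Let QM a b : Q a -> Q b -> Q (a * b). Proof. by have [_ _ _ h] := pQ; exact: h. Qed.

Let Qscalar r : 0 <= r -> Q (scalar_op r).
Proof.
by move=> r0; rewrite -(sqr_sqrtr r0) expr2 scalar_opM; apply: Qsqr; exact: sa_scalar_op.
Qed.

Lemma neg_scalar_notin r : r < 0 -> ~ Q (scalar_op r).
Proof.
move=> r0 Qr; apply: Q1; have -> : -1 = scalar_op (- r^-1) * scalar_op r.
  by rewrite -scalar_opM mulNr mulVf ?lt_eqF// scalar_opN scalar_op1.
by apply: QM => //; apply: Qscalar; rewrite oppr_ge0 invr_le0 ltW.
Qed.

(** For [N > |b|] the element [1 - b / N] is a square, by cstar_sqrt. *)
Let Qbound b : sa b -> exists2 N, 0 < N & Q (scalar_op N - b).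
Proof.
move=> [Ab sb]; exists (opnorm b + 1); first by rewrite ltr_wpDl// opnorm_ge0.
set N := _ + 1; have N0 : 0 < N by rewrite ltr_wpDl// opnorm_ge0.
have [Ac sc] : sa (N^-1%:C%C *: b) by exact: saZ.
have [|s [As ss sE]] := cstar_sqrt hA hcomm Ac sc.
  rewrite opnormZ cabs_real ger0_norm ?invr_ge0 ?(ltW N0)//.
  by rewrite ler_pdivrMl// mulr1 lerDl.
have -> : scalar_op N - b = scalar_op N * (s * s).
  by rewrite sE mulrBr mulr1 scalar_opMl scalerA -rmorphM mulfV ?gt_eqF// rmorph1 scale1r.
by apply: QM; [exact/Qscalar/ltW|exact: Qsqr].
Qed.

(** Otherwise -1 lies in the extensions of Q by b and by - b. Eliminating b between
    the two expressions puts [- q2] in Q, where [q2] is the coefficient of b in the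
    first one; as [N + b] is in Q for large N, so is -1. *)
Lemma max_total b : sa b -> Q b \/ Q (- b).
Proof.
move=> sb.
have step c : sa c -> Q c \/ adjoin Q c (- 1).
  move=> sc; have [|n1] := pselect (adjoin Q c (- 1)); [by right|left].
  apply: (Qmax (adjoin_preordering pQ sc)) => //; first exact: adjoin_sub.
  exact: adjoin_mem.
have [|[q1 [q2 [Qq1 Qq2 E1]]]] := step _ sb; first by left.
have [|[q3 [q4 [Qq3 Qq4 E2]]]] := step _ (saN sb); first by right.
exfalso; apply: Q1.
have Qn : Q (- q2).
  have -> : - q2 = q4 + (q4 * q1 + q2 * q3).
    have F1 : - q4 = q4 * q1 + q4 * q2 * b by rewrite -mulrA -mulrDr -E1 mulrN1.
    have F2 : - q2 = q2 * q3 - q4 * q2 * b.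
      have [A2 _] := Qsa Qq2; have [A4 _] := Qsa Qq4.
      by rewrite (hcomm A4 A2) -mulrA -mulrN -mulrN -mulrDr -E2 mulrN1.
    apply: (addrI (- q4)); rewrite addKr {1}F1 F2.
    by rewrite addrACA subrr addr0.
  by apply: QD => //; apply: QD; exact: QM.
have [N N0 QN] := Qbound (saN sb); rewrite opprK in QN.
have -> : -1 = q2 * (scalar_op N + b) + q1 + scalar_op N * (- q2).
  rewrite mulrDr scalar_opMr mulrN scalar_opMl addrAC [_ - _]addrAC subrr add0r addrC.
  by rewrite E1.
by apply: QD; [apply: QD => //; exact: QM|apply: QM => //; exact/Qscalar/ltW].
Qed.

Definition near_scalar b r :=
  sa b /\ forall e, 0 < e -> Q (b - scalar_op (r - e)) /\ Q (scalar_op (r + e) - b).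

(** The scalar is the Dedekind cut of the t with [b - t] in Q, and totality of Q is
    what makes the two sides of the cut meet. *)
Lemma near_scalar_exists b : sa b -> exists r, near_scalar b r.
Proof.
move=> sb; pose E := [set t | Q (b - scalar_op t)].
have [N N0 QN] := Qbound sb.
have [N' N'0 QN'] := Qbound (saN sb); rewrite opprK in QN'.
have supE : has_sup E.
  split; first by exists (- N'); rewrite /E /= scalar_opN opprK addrC.
  exists N => t Et; rewrite leNgt; apply/negP => Nt.
  apply: (@neg_scalar_notin (N - t)); first by rewrite subr_lt0.
  by rewrite scalar_opB -(subrK b (scalar_op N)) -addrA; exact: QD.
exists (sup E); split=> // e e0; split.
  have [t Et st] := sup_adherent e0 supE.
  have -> : b - scalar_op (sup E - e) = (b - scalar_op t) + scalar_op (t - (sup E - e)).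
    by rewrite [scalar_op (t - _)]scalar_opB addrA subrK.
  by apply: QD => //; apply: Qscalar; rewrite subr_ge0 ltW.
have [|Et] := max_total (saB sb (sa_scalar_op (sup E + e))); last by rewrite -opprB.
move=> Et; have : sup E + e <= sup E by apply: ub_le_sup => //; case: supE.
by rewrite gerDl leNgt e0.
Qed.

Lemma near_scalar_unique b r r' : near_scalar b r -> near_scalar b r' -> r = r'.
Proof.
suff le p q : near_scalar b p -> near_scalar b q -> q <= p.
  by move=> ? ?; apply/le_anti/andP; split; exact: le.
move=> [_ bp] [_ bq]; rewrite leNgt; apply/negP => pq.
have e0 : 0 < (q - p) / 4 by rewrite divr_gt0// subr_gt0.
have [_ B1] := bp _ e0; have [B2 _] := bq _ e0.
apply: (@neg_scalar_notin (p + (q - p) / 4 - (q - (q - p) / 4))); first by lra.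
by rewrite scalar_opB -(subrK b (scalar_op (p + _))) -addrA; exact: QD.
Qed.

Lemma near_scalarD b c r s : near_scalar b r -> near_scalar c s ->
  near_scalar (b + c) (r + s).
Proof.
move=> [sb br] [sc cs]; split=> [|e e0]; first exact: saD.
have e2 : 0 < e / 2 by rewrite divr_gt0.
have [b1 b2] := br _ e2; have [c1 c2] := cs _ e2; split.
  have -> : r + s - e = (r - e / 2) + (s - e / 2) by field.
  by rewrite scalar_opD opprD addrACA; exact: QD.
have -> : r + s + e = (r + e / 2) + (s + e / 2) by field.
by rewrite scalar_opD opprD addrACA; exact: QD.
Qed.

Lemma near_scalarN b r : near_scalar b r -> near_scalar (- b) (- r).
Proof.
move=> [sb br]; split=> [|e e0]; first exact: saN.
have [b1 b2] := br _ e0; split.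
  by rewrite -[- r - e]opprD scalar_opN opprK addrC.
by rewrite opprK addrC (_ : - r + e = - (r - e)) ?scalar_opN// opprB addrC.
Qed.

Lemma near_scalar_op r : near_scalar (scalar_op r) r.
Proof.
split=> [|e e0]; first exact: sa_scalar_op.
by rewrite -!scalar_opB; split; apply: Qscalar; lra.
Qed.

Lemma near_scalarZ b r t : near_scalar b r -> near_scalar (t%:C%C *: b) (t * r).
Proof.
have pos u b' r' : 0 < u -> near_scalar b' r' ->
    near_scalar (u%:C%C *: b') (u * r').
  move=> u0 [sb br]; split=> [|e e0]; first exact: saZ.
  have eu : 0 < e / u by rewrite divr_gt0.
  have [b1 b2] := br _ eu; have Qu := Qscalar (ltW u0); split.
    have -> : u * r' - e = u * (r' - e / u) by field; rewrite gt_eqF.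
    by rewrite scalar_opM -scalar_opMl -mulrBr; exact: QM.
  have -> : u * r' + e = u * (r' + e / u) by field; rewrite gt_eqF.
  by rewrite scalar_opM -scalar_opMl -mulrBr; exact: QM.
case: (ltgtP t 0) => [t0|t0|->] br.
- have := near_scalarN (pos (- t) _ _ _ br).
  by rewrite rmorphN scaleNr mulNr !opprK; apply; rewrite oppr_gt0.
- exact: pos.
- by rewrite rmorph0 scale0r mul0r -scalar_op0; exact: near_scalar_op.
Qed.

(** With [d = b - r] infinitely close to 0, [e - d^2] is the product of [sqrt e + d]
    and [sqrt e - d]. *)
Lemma near_scalar_sqr b r : near_scalar b r -> near_scalar (b * b) (r * r).
Proof.
move=> br; have [sb _] := br.
pose d := b - scalar_op r.
have [sd d0] : near_scalar d 0.
  by rewrite -(subrr r); apply: near_scalarD => //; rewrite -scalar_opN;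
    exact: near_scalar_op.
have bE : b = d + scalar_op r by rewrite subrK.
clearbody d.
have dd : near_scalar (d * d) 0.
  split=> [|e e0]; first exact: saM.
  split.
    rewrite sub0r scalar_opN opprK; apply: QD; first exact: Qsqr.
    exact/Qscalar/ltW.
  have se : 0 < Num.sqrt e by rewrite sqrtr_gt0.
  have [d1 d2] := d0 _ se; rewrite sub0r scalar_opN opprK in d1; rewrite add0r in d2.
  rewrite add0r -(sqr_sqrtr (ltW e0)) expr2 scalar_opM.
  have -> : scalar_op (Num.sqrt e) * scalar_op (Num.sqrt e) - d * d =
      (d + scalar_op (Num.sqrt e)) * (scalar_op (Num.sqrt e) - d).
    have ds : d * scalar_op (Num.sqrt e) = scalar_op (Num.sqrt e) * d.
      by rewrite scalar_opMl scalar_opMr.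
    by rewrite mulrDl !mulrBr ds [RHS]addrC addrA subrK.
  exact: QM.
have -> : b * b = d * d + ((2 * r)%:C%C *: d + scalar_op (r * r)).
  rewrite bE mulrDl !mulrDr scalar_opMr scalar_opMl scalar_opM -!addrA; congr (_ + _).
  by rewrite mulr_natl mulr2n rmorphD scalerDl -addrA.
have := near_scalarD dd
  (near_scalarD (near_scalarZ (2 * r) (conj sd d0)) (near_scalar_op (r * r))).
by rewrite mulr0 !add0r.
Qed.

(** Polarisation reduces products to squares. *)
Lemma near_scalarM b c r s : near_scalar b r -> near_scalar c s ->
  near_scalar (b * c) (r * s).
Proof.
move=> br cs; have [[Ab _] _] := br; have [[Ac _] _] := cs.
have p := near_scalar_sqr (near_scalarD br cs).
have m := near_scalarD (near_scalar_sqr br) (near_scalar_sqr cs).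
have := near_scalarZ 2^-1 (near_scalarD p (near_scalarN m)).
have -> : 2^-1 * ((r + s) * (r + s) + - (r * r + s * s)) = r * s by field.
have -> // : (b + c) * (b + c) - (b * b + c * c) = (1 + 1)%:C%C *: (b * c).
  rewrite mulrDl !mulrDr (hcomm Ac Ab) [b * c + c * c]addrC addrACA [LHS]addrAC.
  by rewrite subrr add0r rmorphD scalerDl rmorph1 scale1r.
by rewrite scalerA -rmorphM mulVf// rmorph1 scale1r.
Qed.

End Maximal.

End Gelfand.

(** * The character of a maximal ordering *)

Section CharacterOfOrdering.
Variables (R : realType) (H : hilbertType R) (A : set 'B(H)).
Hypothesis hA : cstar_subalgebra A.
Hypothesis hcomm : forall a b, A a -> A b -> a * b = b * a.
Variable Q : set 'B(H).
Hypothesis pQ : preordering A Q.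
Hypothesis Q1 : ~ Q (- 1).
Hypothesis Qmax : forall Q', preordering A Q' -> Q `<=` Q' -> ~ Q' (- 1) ->
  Q' `<=` Q.
Implicit Types (a b : 'B(H)) (z : R[i]).

Local Notation near := (near_scalar A Q).
Local Notation im := ('i%C : R[i]).

Let im2 : im * im = -1.
Proof. by rewrite -expr2 sqr_i. Qed.

Let half_double b : (2^-1)%:C%C *: (b + b) = b.
Proof.
rewrite scalerDr -scalerDl -rmorphD (_ : 2^-1 + 2^-1 = 1) ?rmorph1 ?scale1r//.
by field.
Qed.

(** The value at a of the character attached to Q, read off from the real and
    imaginary parts u and w of a. *)
Definition ordering_value a z := exists u w,
  [/\ a = u + im *: w, near u (Re z) & near w (Im z)].

Lemma ordering_value_exists a : A a -> exists z, ordering_value a z.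
Proof.
move=> Aa; have Aa' := cstar_adj hA Aa.
pose u := (2^-1)%:C%C *: (a + adj a).
pose w := (0 +i* - 2^-1)%C *: (a - adj a).
have su : sa A u.
  split; first by apply/(cstarZ hA)/(cstarD hA).
  rewrite /selfadj adjZ adjD adjK addrC; congr (_ *: _).
  by rewrite /Num.conj /= oppr0.
have sw : sa A w.
  split; first by apply/(cstarZ hA)/(cstarB hA).
  rewrite /selfadj adjZ adjB adjK -opprB scalerN -scaleNr; congr (_ *: _).
  by rewrite /Num.conj /= /GRing.opp /= oppr0 opprK.
have [r ur] := near_scalar_exists hA hcomm pQ Q1 Qmax su.
have [s ws] := near_scalar_exists hA hcomm pQ Q1 Qmax sw.
exists (r +i* s)%C, u, w; split=> //.
have imh : im * (0 +i* - 2^-1)%C = (2^-1)%:C%C.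
  by rewrite /GRing.mul /=; congr (_ +i* _)%C; ring.
by rewrite /w scalerA imh -scalerDr addrACA subrr addr0 half_double.
Qed.

Lemma ordering_value_A a z : ordering_value a z -> A a.
Proof.
move=> [u [w [-> [[Au _] _] [[Aw _] _]]]].
by apply: (cstarD hA) => //; exact: (cstarZ hA).
Qed.

Lemma ordering_value_unique a z z' :
  ordering_value a z -> ordering_value a z' -> z = z'.
Proof.
move=> [u [w [-> ur ws]]] [u' [w' [E ur' ws']]].
have [[[_ su] _] [[_ sw] _]] := (ur, ws).
have [[[_ su'] _] [[_ sw'] _]] := (ur', ws').
have E1 : u - u' = im *: (w' - w).
  apply/eqP; rewrite scalerBr subr_eq addrAC eq_sym subr_eq eq_sym.
  by rewrite E addrC.
have E2 : u - u' = - (im *: (w' - w)).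
  have := congr1 (@adj R H) E1; rewrite adjB su su' adjZ adjB sw' sw => ->.
  by rewrite -scaleNr; congr (_ *: _); rewrite /Num.conj /= /GRing.opp /= oppr0.
have E3 : im *: (w' - w) = 0.
  have : im *: (w' - w) + im *: (w' - w) = 0 by rewrite -{1}E1 E2 addNr.
  by move=> D0; rewrite -[LHS]half_double D0 scaler0.
have uu : u = u' by apply/eqP; rewrite -subr_eq0 E1 E3.
have ww : w = w'.
  apply/eqP; rewrite eq_sym -subr_eq0 -oppr_eq0 -scaleN1r -im2 -scalerA E3.
  by rewrite scaler0.
rewrite -uu in ur'; rewrite -ww in ws'.
have := near_scalar_unique hA pQ Q1 ur ur'.
have := near_scalar_unique hA pQ Q1 ws ws'.
by case: z z' {ur ws ur' ws'} => ? ? [? ?] /= -> ->.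
Qed.

Lemma ordering_valueD a b z z' : ordering_value a z -> ordering_value b z' ->
  ordering_value (a + b) (z + z').
Proof.
move=> [u [w [-> ur ws]]] [u' [w' [-> ur' ws']]].
exists (u + u'), (w + w'); split.
- by rewrite scalerDr addrACA.
- by rewrite raddfD; exact: near_scalarD.
- by rewrite raddfD; exact: near_scalarD.
Qed.

Lemma ordering_valueM a b z z' : ordering_value a z -> ordering_value b z' ->
  ordering_value (a * b) (z * z').
Proof.
move=> [u [w [-> ur ws]]] [u' [w' [-> ur' ws']]].
exists (u * u' - w * w'), (u * w' + w * u'); split.
- rewrite mulrDl !mulrDr !bop_scaler !bop_scalel scalerA im2 scaleN1r scalerDr.
  by rewrite [im *: (w * u') - _]addrC addrACA.
- have -> : Re (z * z') = Re z * Re z' + - (Im z * Im z').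
    by case: z z' {ur ws ur' ws'} => ? ? [].
  apply: near_scalarD => //; first exact: near_scalarM.
  by apply: near_scalarN => //; exact: near_scalarM.
- have -> : Im (z * z') = Re z * Im z' + Im z * Re z'.
    by case: z z' {ur ws ur' ws'} => ? ? [].
  by apply: near_scalarD => //; exact: near_scalarM.
Qed.

Lemma ordering_value_scalar z : ordering_value (z *: (1 : 'B(H))) z.
Proof.
exists (scalar_op H (Re z)), (scalar_op H (Im z)); split; [|exact: near_scalar_op..].
rewrite /scalar_op scalerA -scalerDl; congr (_ *: _); exact: complexE.
Qed.

(** Outside A no value exists, and the default value 0 is the one that is_character
    prescribes there. *)
Definition ordering_char (T : 'B(H)) : R[i] :=
  xget 0 [set z | ordering_value T z].

Lemma ordering_charP a z : ordering_value a z -> ordering_char a = z.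
Proof.
move=> az; rewrite /ordering_char; case: xgetP => [y _ ay|/(_ z)//].
exact: ordering_value_unique ay az.
Qed.

Lemma ordering_char_is_character : is_character A ordering_char.
Proof.
split.
- by apply: ordering_charP; have := ordering_value_scalar 1; rewrite scale1r.
- move=> a b /ordering_value_exists[z az] /ordering_value_exists[z' bz].
  rewrite (ordering_charP az) (ordering_charP bz).
  exact/ordering_charP/ordering_valueD.
- move=> c a /ordering_value_exists[z az]; rewrite (ordering_charP az).
  apply: ordering_charP; rewrite -[c *: a](_ : (c *: (1 : 'B(H))) * a = _); last first.
    by rewrite bop_scalel mul1r.
  by apply: ordering_valueM => //; exact: ordering_value_scalar.
- move=> a b /ordering_value_exists[z az] /ordering_value_exists[z' bz].
  rewrite (ordering_charP az) (ordering_charP bz).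
  exact/ordering_charP/ordering_valueM.
- move=> T nAT; rewrite /ordering_char; case: xgetP => // z _ /ordering_value_A.
  by [].
Qed.

(** The value at [a* a] is [|chi a|^2]; were it less than 1, a negative scalar would
    be in Q. *)
Lemma ordering_char_ge1 a : A a -> Q (adj a * a - 1) ->
  1 <= cabs (ordering_char a).
Proof.
move=> Aa Qa; have [z az] := ordering_value_exists Aa.
rewrite (ordering_charP az) leNgt; apply/negP => z1.
have [u [w [aE ur ws]]] := az.
have [[[Au su] _] [[Aw sw] _]] := (ur, ws).
have pE : adj a * a = u * u + w * w.
  rewrite aE adjD adjZ su sw (_ : im^* = - im); last first.
    by rewrite /Num.conj /= /GRing.opp /= oppr0.
  rewrite scaleNr mulrBl !mulrDr !bop_scaler !bop_scalel scalerA im2 scaleN1r.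
  by rewrite (hcomm Aw Au) opprB addrACA subrr addr0.
have : near (adj a * a) (cabs z ^+ 2).
  rewrite pE sqr_cabs !expr2.
  by apply: near_scalarD => //; exact: near_scalar_sqr.
have z2 : cabs z ^+ 2 < 1 by rewrite expr_lt1// cabs_ge0.
pose e := (1 - cabs z ^+ 2) / 2.
have e0 : 0 < e by rewrite divr_gt0// subr_gt0.
move=> [_ /(_ _ e0)[_ Qe]].
apply: (@neg_scalar_notin _ _ _ hA _ pQ Q1 (cabs z ^+ 2 + e - 1)).
  by rewrite /e; lra.
rewrite scalar_opB scalar_op1 -(subrK (adj a * a) (scalar_op _ _)) -addrA.
by have [_ _ QD _] := pQ; exact: QD.
Qed.

End CharacterOfOrdering.

(** * The Gelfand transform is isometric *)

Section GelfandIsometry.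
Variables (R : realType) (H : hilbertType R) (A : set 'B(H)).
Hypothesis hA : cstar_subalgebra A.
Hypothesis hcomm : forall a b, A a -> A b -> a * b = b * a.
Implicit Types (a b : 'B(H)) (Q : set 'B(H)).

Lemma max_preordering Q0 : preordering A Q0 -> ~ Q0 (- 1) ->
  exists Q, [/\ preordering A Q, Q0 `<=` Q, ~ Q (- 1) &
    forall Q', preordering A Q' -> Q `<=` Q' -> ~ Q' (- 1) -> Q' `<=` Q].
Proof.
move=> pQ0 Q01.
pose good Q := [/\ preordering A Q, Q0 `<=` Q & ~ Q (- 1)].
(* The empty set is allowed so that the empty chain has an upper bound. *)
pose P : set (set 'B(H)) := [set Q | Q = set0 \/ good Q].
have [F FP Ftot|Q [PQ Qmax]] := @Zorn_bigcup _ P.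
  have [F0|/existsNP[X /not_implyP[FX X0]]] := pselect (forall X, F X -> X = set0).
    by left; apply/seteqP; split=> // T [X /F0 ->].
  have gF Y y : F Y -> Y y -> good Y.
    by move=> FY Yy; have [Y0|//] := FP _ FY; rewrite Y0 in Yy.
  have gX : good X by have [] := FP _ FX.
  have [[Xsa Xsqr XD XM] X0Q X1] := gX; right; split.
  - split=> [T [Y FY YT]|a sa|a b [Y FY Ya] [Z FZ Zb]|a b [Y FY Ya] [Z FZ Zb]].
    + by have [[Ysa _ _ _] _ _] := gF _ _ FY YT; exact: Ysa.
    + by exists X => //; exact: Xsqr.
    + have [[_ _ YD _] _ _] := gF _ _ FY Ya; have [[_ _ ZD _] _ _] := gF _ _ FZ Zb.
      have [YZ|ZY] := Ftot _ _ FY FZ.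
        by exists Z => //; apply: ZD => //; exact: YZ.
      by exists Y => //; apply: YD => //; exact: ZY.
    + have [[_ _ _ YM] _ _] := gF _ _ FY Ya; have [[_ _ _ ZM] _ _] := gF _ _ FZ Zb.
      have [YZ|ZY] := Ftot _ _ FY FZ.
        by exists Z => //; apply: ZM => //; exact: YZ.
      by exists Y => //; apply: YM => //; exact: ZY.
  - by move=> q /X0Q Xq; exists X.
  - by move=> [Y FY Y1]; have [_ _] := gF _ _ FY Y1; apply.
have [Q_0|[pQ QQ Q1]] := PQ.
  have /Qmax : Q `<` Q0.
    rewrite Q_0; split=> // /(_ 1); apply.
    exact: (preordering1 hA).
  by case; right; split.
exists Q; split=> // Q' pQ' QQ' Q'1; have [//|nQ] := pselect (Q' `<=` Q).
have /Qmax : Q `<` Q' by split.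
by case; right; split=> //; exact: subset_trans QQ'.
Qed.

(** Vectors x of the unit ball with [|a x|] close to [|a| = 1] are almost fixed
    by [a* a], so no combination of sums of squares with [a* a - 1] equals [-1]. *)
Lemma adjoin_norm_proper a : A a -> opnorm a = 1 ->
  ~ adjoin (sos A) (adj a * a - 1) (- 1).
Proof.
move=> Aa a1 [q [q' [Qq Qq' E]]].
pose K := opnorm q'; have K0 : 0 <= K := opnorm_ge0 _.
(* Small enough for the final inequality, 1 / 16 <= 4 d K^2, to fail. *)
pose d := (64 * K ^+ 2 + 2)^-1.
have K2 : 0 <= K ^+ 2 by rewrite exprn_ge0.
have dden : 0 < 64 * K ^+ 2 + 2 by lra.
have d0 : 0 < d by rewrite invr_gt0.
have d1 : d <= 2^-1 by rewrite lef_pV2 ?posrE//; lra.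
have dK : d * (64 * K ^+ 2 + 2) = 1 by rewrite mulVf// gt_eqF.
have [||x [x1 ax]] := @opnorm_gt R H a (1 - d).
- by lra.
- by rewrite a1; lra.
set p := adj a * a in E.
have ax1 : hnorm (a x) <= hnorm x by rewrite (le_trans (opnormP _ _))// a1 mul1r.
have px1 : hnorm (p x) <= 1.
  by rewrite (le_trans (opnormP _ _))// cstar_identity a1 expr1n mul1r.
pose y := (p - 1) x.
have y2 : hnorm y ^+ 2 <= 4 * d.
  have -> : hnorm y ^+ 2 = hnorm (p x) ^+ 2 - 2 * hnorm (a x) ^+ 2 + hnorm x ^+ 2.
    rewrite -rinxx /y bopBE bop1E rinBl !rinBr !rinxx [rin x _]rinC.
    by rewrite (hnorm_adjM a) -/p; ring.
  have : hnorm (p x) ^+ 2 <= 1 by rewrite expr_le1 ?hnorm_ge0.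
  have : hnorm x ^+ 2 <= 1 by rewrite expr_le1 ?hnorm_ge0.
  have : (1 - d) ^+ 2 <= hnorm (a x) ^+ 2.
    by rewrite ler_sqr ?nnegrE ?hnorm_ge0 ?ltW//; lra.
  rewrite sqrrB expr1n mul1r; have : 0 <= d ^+ 2 by rewrite sqr_ge0.
  by move: (d ^+ 2) (hnorm (a x) ^+ 2) (hnorm x ^+ 2) (hnorm (p x) ^+ 2) => *; lra.
have xK : hnorm x ^+ 2 <= K * hnorm y.
  have xE : - hnorm x ^+ 2 = rin (q x) x + rin (q' y) x.
    have -> : - hnorm x ^+ 2 = rin ((- 1 : 'B(H)) x) x.
      by rewrite bopNE bop1E -[- x]sub0r rinBl rin0l sub0r rinxx.
    by rewrite E bopDE rinDl.
  have := sos_ge0 x Qq.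
  have : - rin (q' y) x <= K * hnorm y.
    rewrite -[- _]add0r -(rin0l x) -rinBl sub0r (le_trans (rin_CS _ _))//.
    rewrite hnormN (le_trans (ler_piMr _ x1)) ?hnorm_ge0// opnormP//.
  by move: xE; move: (rin (q x) x) (rin (q' y) x) (K * _) => *; lra.
have x4 : 4^-1 <= hnorm x ^+ 2.
  have x2 : 2^-1 <= hnorm x by rewrite (le_trans _ ax1)//; lra.
  by have : (2^-1) ^+ 2 <= hnorm x ^+ 2; [rewrite ler_sqr ?nnegrE ?hnorm_ge0|lra].
have : (4^-1) ^+ 2 <= (K * hnorm y) ^+ 2.
  by rewrite ler_sqr ?nnegrE ?mulr_ge0 ?hnorm_ge0// (le_trans x4).
rewrite exprMn => /le_trans => /(_ _ (ler_wpM2l K2 y2)).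
by move: dK; move: (K ^+ 2) => k; nra.
Qed.

(** With [b = a / |a|], a maximal preordering containing [b* b - 1] has a character
    with [|chi b| >= 1]. *)
Lemma norming_character a : A a -> 0 < opnorm a ->
  exists chi : character A, opnorm a <= cabs (chi a).
Proof.
move=> Aa a0.
pose b := (opnorm a)^-1%:C%C *: a.
have Ab : A b by exact: (cstarZ hA).
have b1 : opnorm b = 1.
  rewrite opnormZ cabs_real ger0_norm ?invr_ge0 ?opnorm_ge0// mulVf//.
  by rewrite gt_eqF.
have sp : sa A (adj b * b - 1).
  apply: (saB hA); last exact: (sa1 hA).
  split; first by apply: (cstarM hA) => //; exact: (cstar_adj hA).
  by rewrite /selfadj adjM adjK.
have pS := sos_preordering hA hcomm.
have [Q [pQ SQ Q1 Qmax]] := max_preordering (adjoin_preordering hA hcomm pS sp)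
  (adjoin_norm_proper Ab b1).
have chiP := ordering_char_is_character hA hcomm pQ Q1 Qmax.
exists (Character chiP).
have := ordering_char_ge1 hA hcomm pQ Q1 Qmax Ab (SQ _ (adjoin_mem hA _ pS)).
rewrite /b; have [_ _ -> // _ _] := chiP.
rewrite cabsM cabs_real ger0_norm ?invr_ge0 ?opnorm_ge0//.
by rewrite ler_pdivlMl// mulr1.
Qed.

Lemma gelfand_le a (r : R) : A a -> 0 <= r ->
  (forall chi : character A, cabs (chi a) <= r) -> opnorm a <= r.
Proof.
move=> Aa r0 ar; rewrite leNgt; apply/negP => ra.
have [chi ac] := norming_character Aa (le_lt_trans r0 ra).
by have := le_trans ac (ar chi); rewrite leNgt ra.
Qed.

Lemma gelfand_eq a b : A a -> A b ->
  (forall chi : character A, chi a = chi b) -> a = b.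
Proof.
move=> Aa Ab ab; apply/eqP; rewrite -subr_eq0; apply/eqP/opnorm_le0.
apply: gelfand_le => // [|chi]; first exact: (cstarB hA).
by rewrite (charB hA)// ab subrr cabs0.
Qed.

End GelfandIsometry.

(** * Finite sums and the conditional expectation *)

Section CharacterSpace.
Variables (R : realType) (H : hilbertType R) (A : set 'B(H)).

Lemma eval_continuous (T : 'B(H)) :
  continuous (fun chi : character A => (chi T : R[i]^o)).
Proof.
move=> chi; apply: (@continuous_comp _ _ _ (@char_ptws R H A) (fun f => f T)).
  exact: initial_continuous.
exact: (@proj_continuous _ (fun=> R[i]^o) T).
Qed.

Lemma open_eval_close (T : 'B(H)) (z : R[i]) (e : R) :
  open [set chi : character A | cabs (chi T - z) < e].
Proof.
have -> : [set chi : character A | cabs (chi T - z) < e] =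
   (fun chi : character A => (chi T : R[i]^o)) @^-1` (ball (z : R[i]^o) e%:C%C).
  apply/seteqP; split=> chi /=; rewrite -ball_normE /= -opprB normrN cabsE ltcR//.
apply: open_comp => [? _|]; first exact: eval_continuous.
exact: ball_open.
Qed.

(** The basic neighbourhoods of the Gelfand topology, cut down to V. *)
Lemma open_eval_close_seq (I : eqType) (s : seq I) (T : I -> 'B(H)) (z : I -> R[i])
    (e : R) (V : set (character A)) : open V ->
  open [set chi | V chi /\ forall i, i \in s -> cabs (chi (T i) - z i) < e].
Proof.
move=> oV; elim: s => [|i s IH].
  rewrite (_ : mkset _ = V)//; apply/seteqP; split=> chi; first by case.
  by move=> Vchi; split.
have := openI IH (open_eval_close (T i) (z i) e).
congr open; apply/seteqP; split=> chi.
  move=> [[Vchi close_s] close_i]; split=> // j.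
  by rewrite inE => /predU1P[->//|]; exact: close_s.
move=> [Vchi close_s]; split; last by apply: close_s; rewrite inE eqxx.
by split=> // j js; apply: close_s; rewrite inE js orbT.
Qed.

Lemma bumps_supp (V : set (character A)) z (chi : character A) :
  bumps V z -> chi z != 0 -> V chi.
Proof. by move=> [_ _ _ sV] z0; apply: sV; exact: subset_closure. Qed.

End CharacterSpace.

Section FiniteSums.
Variables (R : realType) (H : hilbertType R) (G : groupType).
Implicit Types (F : seq ('B(H) * G)) (g : G).

(** A list of pairs (a, g) stands for the formal sum of the a g. Lists are not
    normalised (g may be repeated), so that products and adjoints of formal sums are
    plain list comprehensions; coef collects the terms at g. *)
Definition coef F g : 'B(H) := \sum_(p <- F | p.2 == g) p.1.

Definition coefs_in (A : set 'B(H)) F := forall p, p \in F -> A p.1.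

Lemma big_group_snd (V : nmodType) F (Phi : 'B(H) * G -> V) (r : seq G) :
  uniq r -> (forall p, p \in F -> p.2 \in r) ->
  \sum_(p <- F) Phi p = \sum_(g <- r) \sum_(p <- F | p.2 == g) Phi p.
Proof.
move=> ur Fr; rewrite (exchange_big_dep predT)//=.
rewrite big_seq [RHS]big_seq; apply: eq_bigr => p /Fr pr.
rewrite big_mkcond (bigD1_seq p.2)//= eqxx big1 ?addr0// => g.
by rewrite eq_sym => /negPf->.
Qed.

End FiniteSums.

Section Representation.
Variables (R : realType) (H : hilbertType R) (G : groupType) (U : G -> 'B(H)).
Hypothesis hU : unitary_rep U.
Implicit Types (F : seq ('B(H) * G)) (g : G).

Definition fsum F : 'B(H) := \sum_(p <- F) p.1 * U p.2.

Lemma rep1 : U 1%g = 1. Proof. by have [] := hU. Qed.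
Lemma repM g h : U (g * h)%g = U g * U h.
Proof. by have [_ h' _] := hU; exact: h'. Qed.
Lemma rep_unitary g : unitary_op (U g). Proof. by have [_ _] := hU. Qed.
Lemma rep_adj g : adj (U g) = U g^-1%g.
Proof.
have [UU _] := rep_unitary g.
rewrite -[LHS]mulr1 -rep1 -(mulgV g) repM mulrA UU mul1r//.
Qed.
Lemma rep_opnorm g : opnorm (U g) <= 1.
Proof. exact/unitary_opnorm/rep_unitary. Qed.
Lemma repV g : U g^-1%g * U g = 1.
Proof. by rewrite -repM mulVg rep1. Qed.

Lemma alpha_commute g (a : 'B(H)) : U g * a = alpha U g a * U g.
Proof. by rewrite /alpha rep_adj -!mulrA repV mulr1. Qed.

Lemma fsum_coef F (r : seq G) : uniq r -> (forall p, p \in F -> p.2 \in r) ->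
  fsum F = \sum_(g <- r) coef F g * U g.
Proof.
move=> ur Fr; rewrite /fsum (big_group_snd _ ur Fr); apply: eq_bigr => g _.
by rewrite /coef big_distrl; apply: eq_bigr => p /eqP->.
Qed.

End Representation.

Section Expectation.
Variables (R : realType) (H : hilbertType R) (G : groupType).
Variables (A : set 'B(H)) (U : G -> 'B(H)).
Hypothesis hA : cstar_subalgebra A.
Hypothesis hcomm : forall a b, A a -> A b -> a * b = b * a.
Hypothesis hU : unitary_rep U.
Hypothesis halpha : forall g, star_automorphism A (alpha U g).
Hypothesis hyp : forall (G0 : set G) (c : G -> R[i]) (V : set (character A)),
  finite_set G0 -> ~ G0 1%g -> open V -> V !=set0 ->
  (forall g, G0 g -> forall m, V m -> beta hA (halpha g) m = m) ->
  exists2 z, bumps V z & opnorm z <= opnorm (z * (1 + \sum_(g \in G0) c g *: U g)).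
Implicit Types (s : seq G) (a : G -> 'B(H)) (V : set (character A)).

Local Notation bt g m := (beta hA (halpha g) m).

Lemma betaE g (m : character A) b : A b -> bt g m b = m (alpha U g b).
Proof. by move=> Ab; rewrite /= mem_set. Qed.

Lemma alpha_in g b : A b -> A (alpha U g b).
Proof. by have [[h _ _] _] := halpha g; exact: h. Qed.

(** The hypothesis on bumps for the empty set of group elements. *)
Lemma bump_exists V : open V -> V !=set0 -> exists z, bumps V z.
Proof.
move=> oV V0; have [|//|//|//|//|z Vz _] := @hyp set0 (fun=> 0) V.
  exact: finite_set0.
by exists z.
Qed.

(** Near a point chi the element [z a_g] is almost the constant [chi (z a_g)], so that
    multiplication by a bump supported near chi turns the sum into a multiple of a
    combination of the [U_g] with scalar coefficients. That this works for every z
    supported in V, not just for one, is what expectation_contractive needs. *)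
Lemma fixed_points_estimate s a V z : uniq s -> 1%g \in s ->
  (forall g, g \in s -> A (a g)) -> open V ->
  (forall g, g \in s -> forall m, V m -> bt g m = m) ->
  A z -> (forall chi : character A, chi z != 0 -> V chi) ->
  opnorm (z * a 1%g) <= opnorm (z * \sum_(g <- s) a g * U g).
Proof.
move=> us s1 Aa oV fixV Az zV.
have Aza g : g \in s -> A (z * a g) by move=> /Aa; exact: (cstarM hA).
set T := \sum_(g <- s) _.
apply: (gelfand_le hA hcomm) => [||chi]; [exact: Aza|exact: opnorm_ge0|].
have [->|c1] := eqVneq (chi (z * a 1%g)) 0; first by rewrite cabs0 opnorm_ge0.
have Vchi : V chi.
  apply: zV; apply: contraNneq c1; rewrite (charM chi Az (Aa _ s1)) => ->.
  by rewrite mul0r.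
apply/ler_addgt0Pr => e e0.
have n0 : 0 < (size s).+1%:R :> R by rewrite ltr0n.
pose d := e / (size s).+1%:R; have d0 : 0 < d by rewrite divr_gt0.
pose W := [set m : character A | V m /\ forall g, g \in s ->
  cabs (m (z * a g) - chi (z * a g)) < d].
have oW : open W by exact: open_eval_close_seq.
have W0 : W !=set0 by exists chi; split=> // g _; rewrite subrr cabs0.
pose P := [pred g | (g \in s) && (g != 1%g)].
pose c g := chi (z * a g) / chi (z * a 1%g).
have [|||||w Ww] := @hyp [set` P] c W.
- by apply: (sub_finite_set _ (finite_seq s)) => g /= /andP[].
- by rewrite /= inE eqxx andbF.
- by [].
- by [].
- by move=> g /= /andP[gs _] m [Vm _]; exact: fixV.
have [Aw _ w1 _] := Ww.
rewrite w1 => hw.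
have sumE : chi (z * a 1%g) *: (w * (1 + \sum_(g \in [set` P]) c g *: U g)) =
    \sum_(g <- s) (chi (z * a g) *: w) * U g.
  rewrite -(@bigfs _ _ _ _ s)//; last first.
    by move=> g; rewrite /P /= => /andP[gs _]; rewrite gs.
  have -> : 1 + \sum_(g <- s | P g) c g *: U g = \sum_(g <- s) c g *: U g.
    rewrite (bigD1_seq 1%g)//= /c mulfV// scale1r (rep1 hU); congr (_ + _).
    rewrite big_seq_cond [RHS]big_seq_cond; apply: eq_bigl => g /=.
    by rewrite andbA andbb.
  rewrite big_distrr scaler_sumr; apply: eq_bigr => g _ /=.
  by rewrite bop_scaler scalerA bop_scalel /c mulrC divfK.
have wzT : w * (z * T) = \sum_(g <- s) (w * (z * a g)) * U g.
  by rewrite /T !big_distrr; apply: eq_bigr => g _ /=; rewrite !mulrA.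
have close_g g : g \in s -> opnorm (w * (z * a g) - chi (z * a g) *: w) <= d.
  move=> gs; apply: (gelfand_le hA hcomm) => [||m].
  - by apply: (cstarB hA); [apply: (cstarM hA) => //; exact: Aza|exact: (cstarZ hA)].
  - exact: ltW.
  have Azg := Aza _ gs.
  rewrite (charB hA)//; [|exact: (cstarM hA)|exact: (cstarZ hA)].
  rewrite (charM m Aw Azg) (charZ m _ Aw) [m w * _]mulrC -mulrBl cabsM.
  have [->|mw] := eqVneq (m w) 0; first by rewrite cabs0 mulr0 ltW.
  have [_ /(_ _ gs)/ltW mz] := bumps_supp Ww mw.
  by rewrite -[d]mulr1 ler_pM ?cabs_ge0// -w1 (char_le hA).
have -> : cabs (chi (z * a 1%g)) = cabs (chi (z * a 1%g)) * 1 by rewrite mulr1.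
rewrite (le_trans (ler_wpM2l (cabs_ge0 _) hw))// -opnormZ sumE.
have -> : \sum_(g <- s) chi (z * a g) *: w * U g =
   w * (z * T) - \sum_(g <- s) (w * (z * a g) - chi (z * a g) *: w) * U g.
  rewrite wzT -sumrB; apply: eq_bigr => g _.
  by rewrite -mulrBl opprB addrC subrK.
rewrite (le_trans (opnormB _ _))// lerD//.
  by rewrite (le_trans (opnormM _ _))// w1 mul1r.
rewrite (le_trans (opnorm_sum _ _ _))//.
rewrite (@le_trans _ _ (\sum_(g <- s) d))//.
  rewrite big_seq [leRHS]big_seq; apply: ler_sum => g gs.
  rewrite (le_trans (opnormM _ _))// -[leRHS]mulr1 ler_pM ?opnorm_ge0 ?close_g//.
  exact: rep_opnorm.
rewrite big_const_seq count_predT iter_addr addr0 -mulr_natl /d.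
by rewrite mulrA ler_pdivrMr// mulrC ler_wpM2l ?(ltW e0)// ler_nat leqnSn.
Qed.

(** Since M is Hausdorff, an element moving some point of V moves a whole
    neighbourhood of that point off itself. *)
Lemma shrink_open s V : open V -> V !=set0 ->
  exists W, [/\ open W, W !=set0, W `<=` V & forall g, g \in s ->
    (forall m, W m -> bt g m = m) \/ (forall m, W m -> ~ W (bt g m))].
Proof.
move=> oV V0; elim: s => [|g s [W [oW W0 WV Ws]]]; first by exists V; split.
have [fixg|] := pselect (forall m, W m -> bt g m = m).
  exists W; split=> // h; rewrite inE => /predU1P[->|]; [by left|exact: Ws].
move=> /existsNP[m /not_implyP[Wm mg]].
have [b Ab bm] : exists2 b, A b & bt g m b <> m b.
  apply: contrapT => nb; apply: mg; apply: char_ext => b Ab.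
  by apply: contrapT => bm; apply: nb; exists b.
pose e := cabs (bt g m b - m b) / 2.
have e0 : 0 < e.
  by rewrite divr_gt0// lt0r cabs_ge0 cabs_eq0 subr_eq0 andbT; exact/eqP.
pose W' := W `&` [set m' : character A | cabs (m' b - m b) < e] `&`
  [set m' : character A | cabs (m' (alpha U g b) - m (alpha U g b)) < e].
exists W'; split.
- by apply: openI; [apply: openI => //|]; exact: open_eval_close.
- by exists m; split; [split|] => //=; rewrite subrr cabs0.
- by move=> m' [[/WV]].
move=> h; rewrite inE => /predU1P[->|hs].
  right=> m' [_ /= m1] [[_ /= m2] _].
  have := cabsD (bt g m b - bt g m' b) (bt g m' b - m b).
  rewrite addrA subrK -(cabsN (bt g m b - _)) opprB leNgt => /negP; apply.
  rewrite [ltRHS](_ : _ = e + e); last by rewrite /e; field.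
  by rewrite ltrD// !betaE.
have [fixh|moveh] := Ws _ hs; [left|right].
  by move=> m' [[/fixh]].
by move=> m' [[Wm' _] _] [[Wb _] _]; exact: moveh Wm' Wb.
Qed.

Lemma beta1 (m : character A) : bt 1%g m = m.
Proof.
apply: char_ext => b Ab.
by rewrite betaE// /alpha (rep1 hU) adj1 mulr1 mul1r.
Qed.

(** Suppose that [|a_1|] exceeds the norm of the sum T at some character. For z
    supported in a small open set given by shrink_open near that character, [z T z]
    only retains the terms whose group element fixes that set, since
    [z a U_g z = a z alpha_g(z) U_g]; fixed_points_estimate applies to them and gives
    [|z^2 a_1| <= |T|]. *)
Lemma expectation_contractive s a : uniq s -> 1%g \in s ->
  (forall g, g \in s -> A (a g)) ->
  opnorm (a 1%g) <= opnorm (\sum_(g <- s) a g * U g).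
Proof.
move=> us s1 Aa; set T := \sum_(g <- s) _; set r := opnorm T.
have r0 : 0 <= r := opnorm_ge0 T.
rewrite leNgt; apply/negP => ra.
have [chi chia] := norming_character hA hcomm (Aa _ s1) (le_lt_trans r0 ra).
have {ra chia} := lt_le_trans ra chia; set c := cabs _ => rc.
(* A level separating r from c: |m (a_1)| >= k on W0. *)
pose k := (c + r) / 2; have kr : r < k by rewrite /k; lra.
have k0 : 0 < k := le_lt_trans r0 kr.
pose W0 := [set m : character A | cabs (m (a 1%g) - chi (a 1%g)) < (c - r) / 2].
have [||V [oV V0 VW Vs]] := @shrink_open s W0.
- exact: open_eval_close.
- by exists chi; rewrite /W0 /= subrr cabs0 divr_gt0// subr_gt0.
have [z Vz] := bump_exists oV V0; have [Az _ z1 _] := Vz.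
pose s' := [seq g <- s | `[< forall m, V m -> bt g m = m >]].
have s's g : g \in s' -> g \in s by rewrite mem_filter => /andP[].
have Azz : A (z * z) by exact: (cstarM hA).
have zgz g : g \in s -> z * alpha U g z =
    if `[< forall m, V m -> bt g m = m >] then z * z else 0.
  move=> gs; have Agz := alpha_in g Az.
  apply: (gelfand_eq hA hcomm) => [||m]; first exact: (cstarM hA).
    by case: ifP => _ //; exact: (cstar_zero hA).
  rewrite (charM m Az Agz) -betaE//.
  case: asboolP => [fixg|nfix].
    rewrite (charM m Az Az).
    have [->|mz] := eqVneq (m z) 0; first by rewrite !mul0r.
    by rewrite fixg//; exact: bumps_supp mz.
  have m0 : m 0 = 0.
    by have := charZ m 0 (cstar_zero hA); rewrite scale0r mul0r.
  rewrite m0; have [->|mz] := eqVneq (m z) 0; first by rewrite mul0r.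
  have [//|moveg] := Vs _ gs.
  have [->|bz] := eqVneq (bt g m z) 0; first by rewrite mulr0.
  by case: (moveg m (bumps_supp Vz mz)); exact: bumps_supp bz.
have zTz : z * T * z = z * z * \sum_(g <- s') a g * U g.
  rewrite /T !big_distrr big_distrl big_filter /= [RHS]big_mkcond /=.
  rewrite big_seq [RHS]big_seq; apply: eq_bigr => g gs.
  rewrite -!mulrA (alpha_commute hU) [a g * _]mulrA (hcomm (Aa _ gs) (alpha_in g Az)).
  rewrite (mulrA z) (mulrA z (alpha U g z)) zgz//.
  case: ifP => _; first by rewrite !mulrA.
  by rewrite !mul0r.
have zza : opnorm (z * z * a 1%g) <= r.
  have := @fixed_points_estimate s' a V (z * z) _ _ _ oV _ Azz _.
  rewrite -zTz => h; apply: le_trans (h _ _ _ _ _) _.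
  - exact: filter_uniq.
  - by rewrite mem_filter s1 andbT; apply/asboolP => m _; exact: beta1.
  - by move=> g /s's; exact: Aa.
  - by move=> g; rewrite mem_filter => /andP[/asboolP].
  - move=> m; rewrite (charM m Az Az) mulf_eq0 orbb; exact: bumps_supp.
  by rewrite (le_trans (opnormM _ _))// z1 mulr1 (le_trans (opnormM _ _))// z1 mul1r.
have zq (m : character A) : cabs (m z) <= Num.sqrt (r / k).
  rewrite -(@ler_sqr R) ?nnegrE ?cabs_ge0 ?sqrtr_ge0//.
  rewrite (sqr_sqrtr (divr_ge0 r0 (ltW k0))) ler_pdivlMr//.
  have [->|mz] := eqVneq (m z) 0; first by rewrite cabs0 expr0n mul0r.
  have km : k <= cabs (m (a 1%g)).
    have := VW _ (bumps_supp Vz mz); rewrite /W0 /= => m1.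
    have := cabsD (chi (a 1%g) - m (a 1%g)) (m (a 1%g)).
    by rewrite subrK -/c -cabsN opprB /k => ?; lra.
  rewrite (le_trans _ zza)//.
  rewrite (le_trans _ (char_le hA m (cstarM hA Azz (Aa _ s1))))//.
  rewrite (charM m Azz (Aa _ s1)) (charM m Az Az) !cabsM -expr2.
  by rewrite ler_wpM2l ?sqr_ge0.
have := gelfand_le hA hcomm Az (sqrtr_ge0 _) zq; rewrite z1 leNgt => /negP; apply.
rewrite -[ltRHS]sqrtr1 ltr_sqrt// ltr_pdivrMr// mul1r//.
Qed.

(** Translate g to the identity by the unitary [U_g^-1]. *)
Lemma coef_contractive (F : seq ('B(H) * G)) g : coefs_in A F ->
  opnorm (coef F g) <= opnorm (fsum U F).
Proof.
move=> AF.
pose F' := [seq (p.1, (p.2 * g^-1)%g) | p <- F].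
have F'E : fsum U F' = fsum U F * U g^-1%g.
  by rewrite /fsum big_map big_distrl; apply: eq_bigr => p _ /=; rewrite repM// mulrA.
have cF' : coef F' 1%g = coef F g.
  rewrite /coef big_map; apply: eq_bigl => p /=.
  by rewrite -(inj_eq (mulIg g)) -mulgA mulVg mulg1 mul1g.
have AF' : coefs_in A F' by move=> _ /mapP[p pF ->]; exact: (AF _ pF).
pose r := undup (1%g :: [seq p.2 | p <- F']).
have ur : uniq r := undup_uniq _.
have Fr p : p \in F' -> p.2 \in r.
  by move=> pF; rewrite mem_undup inE map_f ?orbT.
have r1 : 1%g \in r by rewrite mem_undup inE eqxx.
have Ac h : A (coef F' h).
  rewrite /coef big_seq_cond; apply: (cstar_sum hA) => p /andP[/AF' ? _]//.
rewrite -cF' (le_trans (expectation_contractive ur r1 (fun h _ => Ac h)))//.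
rewrite -(fsum_coef _ ur Fr) F'E (le_trans (opnormM _ _))//.
by rewrite ler_piMr ?opnorm_ge0// rep_opnorm.
Qed.

End Expectation.

(** * Multipliers given by an approximately invariant sequence *)

Section FiniteSupport.
Variables (V : nmodType) (I : choiceType).

Lemma fsum_seq (S : seq I) (f : I -> V) : uniq S ->
  (forall i, i \notin S -> f i = 0) ->
  \sum_(i \in [set: I]) f i = \sum_(i <- S) f i.
Proof.
move=> uS f0; rewrite (fsbigE S)//; last by move=> i _; exact: f0.
by apply: eq_bigl => i; rewrite in_setT.
Qed.

Lemma sum_supp (S L : seq I) (f : I -> V) : uniq S -> uniq L ->
  {subset S <= L} -> (forall i, i \notin S -> f i = 0) ->
  \sum_(i <- L) f i = \sum_(i <- S) f i.
Proof.
move=> uS uL SL f0; rewrite -(fsum_seq uS f0) -(fsum_seq uL)// => i iL.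
by apply: f0; apply: contra iL; exact: SL.
Qed.

Lemma finite_supp_seq (f : I -> V) : finite_set [set i | f i != 0] ->
  exists S, uniq S /\ forall i, i \notin S -> f i = 0.
Proof.
move=> /finite_seqP[S SE]; exists (undup S); split; first exact: undup_uniq.
move=> i; rewrite mem_undup => iS; apply/eqP; apply: contraNT iS => fi.
have : [set i | f i != 0] i by [].
by rewrite SE.
Qed.

End FiniteSupport.

Lemma ler_sum_sub (R : realDomainType) (I : choiceType) (S L : seq I) (f : I -> R) :
  uniq S -> uniq L -> {subset S <= L} -> (forall i, 0 <= f i) ->
  \sum_(i <- S) f i <= \sum_(i <- L) f i.
Proof.
move=> uS uL SL f0.
have -> : \sum_(i <- S) f i = \sum_(i <- S) (if i \in S then f i else 0).
  by apply: eq_big_seq => i ->.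
rewrite -(sum_supp uS uL SL); last by move=> i /negPf->.
by apply: ler_sum => i _; case: ifP.
Qed.

(** If v is the vector on the left, then [|v|^2] is the sum of the [Re <z_s, y_s v>],
    and the squares [|y_s v|^2] add up to [|v|^2]. *)
Lemma row_contraction (R : realType) (K : hilbertType R) (I : eqType) (S : seq I)
    (y : I -> 'B(K)) (z : I -> K) : (forall s, s \in S -> selfadj (y s)) ->
  \sum_(s <- S) y s * y s = 1 ->
  hnorm (\sum_(s <- S) y s (z s)) ^+ 2 <= \sum_(s <- S) hnorm (z s) ^+ 2.
Proof.
move=> sy y1; set v := \sum_(s <- S) _.
have yv : \sum_(s <- S) hnorm (y s v) ^+ 2 = hnorm v ^+ 2.
  rewrite -[RHS]rinxx -[X in rin X v]bop1E -y1 bop_sumE rin_suml.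
  rewrite big_seq [RHS]big_seq; apply: eq_bigr => s /sy ss.
  by rewrite bopME -{2}ss rin_adjl rinxx.
have : 2 * hnorm v ^+ 2 <= \sum_(s <- S) hnorm (z s) ^+ 2 + hnorm v ^+ 2.
  rewrite -[in leRHS]yv -big_split /= -rinxx {1}/v rin_suml mulr_sumr.
  rewrite [leLHS]big_seq [leRHS]big_seq; apply: ler_sum => s /sy ss.
  have -> : rin (y s (z s)) v = rin (z s) (y s v) by rewrite rin_adj ss.
  have := sqr_ge0 (hnorm (z s) - hnorm (y s v)); rewrite sqrrB.
  by have := rin_CS (z s) (y s v); rewrite -mulr_natl; lra.
lra.
Qed.

Section Multiplier.
Variables (R : realType) (H K : hilbertType R) (G : groupType).
Variables (A : set 'B(H)) (U : G -> 'B(H)).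
Variables (pi : 'B(H) -> 'B(K)) (u : G -> 'B(K)).
Hypothesis hA : cstar_subalgebra A.
Hypothesis hcomm : forall a b, A a -> A b -> a * b = b * a.
Hypothesis hU : unitary_rep U.
Hypothesis halpha : forall g b, A b -> A (alpha U g b).
Hypothesis hcoef : forall F (g : G), coefs_in A F ->
  opnorm (coef F g) <= opnorm (fsum U F).
Hypothesis pi1 : pi 1 = 1.
Hypothesis hpi : star_morphism A pi.
Hypothesis hu : unitary_rep u.
Hypothesis hcov : forall g a, A a -> u g * pi a * adj (u g) = pi (alpha U g a).
Implicit Types (F : seq ('B(H) * G)) (g s t : G).

Definition isum F : 'B(K) := \sum_(p <- F) pi p.1 * u p.2.

Lemma coef_in F g : coefs_in A F -> A (coef F g).
Proof.
move=> AF; rewrite /coef big_seq_cond; apply: (cstar_sum hA) => p /andP[pF _].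
exact: (AF _ pF).
Qed.

Lemma sum_regroup F (r : seq G) (v : G -> 'B(K)) : coefs_in A F -> uniq r ->
  (forall p, p \in F -> p.2 \in r) ->
  \sum_(p <- F) pi p.1 * v p.2 = \sum_(g <- r) pi (coef F g) * v g.
Proof.
move=> AF ur Fr; rewrite (big_group_snd _ ur Fr); apply: eq_bigr => g _.
rewrite /coef -[X in pi X]big_filter -[LHS]big_filter.
rewrite (mor_sum hA hpi) => [|p]; last first.
  by rewrite mem_filter => /andP[_ /AF].
rewrite big_distrl [LHS]big_seq [RHS]big_seq; apply: eq_bigr => p /=.
by rewrite mem_filter => /andP[/eqP->].
Qed.

(** The formal adjoint of F times F. *)
Definition star F : seq ('B(H) * G) :=
  [seq (alpha U q.2^-1%g (adj q.1 * p.1), (q.2^-1 * p.2)%g) | q <- F, p <- F].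

Lemma star_in F : coefs_in A F -> coefs_in A (star F).
Proof.
move=> AF _ /allpairsP[[q p] [qF pF ->]] /=; apply: halpha.
by apply: (cstarM hA); [apply: (cstar_adj hA)|]; exact: AF.
Qed.

Lemma fsum_star F : fsum U (star F) = adj (fsum U F) * fsum U F.
Proof.
rewrite /fsum /star big_allpairs_dep adj_sum big_distrl; apply: eq_bigr => q _ /=.
rewrite big_distrr; apply: eq_bigr => p _ /=.
by rewrite repM// adjM (rep_adj hU) mulrA -(alpha_commute hU) !mulrA.
Qed.

Lemma cov_commute g a : A a -> pi (alpha U g a) * u g = u g * pi a.
Proof.
by move=> Aa; rewrite -hcov// (rep_adj hu) -!mulrA (repV hu) mulr1.
Qed.

Variables (x : G -> 'B(H)) (S : seq G).
Hypothesis uS : uniq S.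
Hypothesis Ax : forall s, A (x s).
Hypothesis sx : forall s, selfadj (x s).
Hypothesis xS : forall s, s \notin S -> x s = 0.
Hypothesis x1 : \sum_(s <- S) x s * x s = 1.

Local Notation y s := (pi (x s)).

(** [V* (lambda_g (x) u_g) V], where V is the isometry from K to [l^2(G, K)] given by
    [V xi = (y_s xi)_s]; hence phi below is the compression by V of the
    representation of the formal sums by [lambda (x) (pi, u)]. *)
Definition theta g : 'B(K) := \sum_(s <- S) y s * u g * y (g^-1 * s)%g.

Definition phi F : 'B(K) := \sum_(p <- F) pi p.1 * theta p.2.

Let sy s : selfadj (y s).
Proof. by rewrite /selfadj -(mor_adj hpi)// sx. Qed.

Let y1 : \sum_(s <- S) y s * y s = 1.
Proof.
rewrite -pi1 -x1 (mor_sum hA hpi); last by move=> s _; exact: (cstarM hA).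
by apply: eq_bigr => s _; rewrite (morM hpi).
Qed.

Let y0 s : s \notin S -> y s = 0.
Proof. by move=> /xS ->; rewrite (mor0 hA hpi). Qed.

Let yC s a : A a -> y s * pi a = pi a * y s.
Proof. by move=> Aa; rewrite -!(morM hpi)// hcomm. Qed.

(** The coordinate at s of the vector that F makes of [V xi] in [l^2(G, K)]. *)
Let zeta F (xi : K) s : K :=
  \sum_(p <- F) (pi p.1 * u p.2 * y (p.2^-1 * s)%g) xi.

Lemma phi_zeta F xi : coefs_in A F -> phi F xi = \sum_(s <- S) y s (zeta F xi s).
Proof.
move=> AF; rewrite /phi bop_sumE.
under [RHS]eq_bigr do rewrite /zeta bop_sum.
rewrite exchange_big big_seq [RHS]big_seq; apply: eq_bigr => p pF.
rewrite /theta bopME bop_sumE bop_sum; apply: eq_bigr => s _.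
rewrite !bopME -[pi p.1 _]bopME -yC ?bopME//; exact: AF.
Qed.

(** The Kadison-Schwarz inequality for the compression phi of a representation. The
    reindexing of s by [q t] is the unitarity of left translation on [l^2(G, K)]. *)
Lemma phi_schwarz F xi : coefs_in A F ->
  hnorm (phi F xi) ^+ 2 <= rin (phi (star F) xi) xi.
Proof.
move=> AF; rewrite phi_zeta//.
apply: le_trans (row_contraction _ (fun s _ => sy s) y1) _.
(* A finite set containing the support of zeta and all the translates q S. *)
pose L := undup (S ++ [seq (q.2 * t)%g | q <- F, t <- S]).
apply: (@le_trans _ _ (\sum_(s <- L) hnorm (zeta F xi s) ^+ 2)).
  apply: ler_sum_sub => //; first exact: undup_uniq.
    by move=> s sS; rewrite mem_undup mem_cat sS.
  by move=> s; rewrite exprn_ge0 ?hnorm_ge0.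
pose T (p q : 'B(H) * G) s :=
  rin ((pi p.1 * u p.2 * y (p.2^-1 * s)%g) xi) ((pi q.1 * u q.2 * y (q.2^-1 * s)%g) xi).
have -> : \sum_(s <- L) hnorm (zeta F xi s) ^+ 2 =
    \sum_(q <- F) \sum_(p <- F) \sum_(s <- L) T p q s.
  under eq_bigr => s _.
    rewrite -rinxx /zeta rin_sumr; under eq_bigr do rewrite rin_suml.
    over.
  rewrite exchange_big; apply: eq_bigr => q _.
  by rewrite exchange_big.
rewrite /phi /star big_allpairs_dep bop_sumE rin_suml big_seq [leRHS]big_seq.
apply: ler_sum => q qF; rewrite bop_sumE rin_suml big_seq [leRHS]big_seq.
apply: ler_sum => p pF /=.
have [Ap Aq] := (AF _ pF, AF _ qF).
have Aqp : A (adj q.1 * p.1) by apply: (cstarM hA) => //; exact: (cstar_adj hA).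
pose qS := [seq (q.2 * t)%g | t <- S].
have uqS : uniq qS by rewrite map_inj_uniq// => ? ? /mulgI.
rewrite (@sum_supp _ _ qS)//; [|exact: undup_uniq| |]; last first.
- move=> s sqS; have qs : (q.2^-1 * s)%g \notin S.
    apply: contra sqS => sS; apply/mapP; exists (q.2^-1 * s)%g => //.
    by rewrite mulgA mulgV mul1g.
  by rewrite /T (y0 qs) mulr0 bop0E rin0r.
- move=> _ /mapP[t tS ->]; rewrite mem_undup mem_cat; apply/orP; right.
  by apply/allpairsP; exists (q, t).
rewrite big_map /theta bop_sumE bop_sum rin_suml; apply: ler_sum => t _ /=.
rewrite /T (mulgA q.2^-1%g q.2) mulVg mul1g invgM invgK -!mulgA.
set Y := y _; set v := Y xi.
rewrite !bopME -/v.
have -> : pi (alpha U q.2^-1 (adj q.1 * p.1)) (y t (u (q.2^-1 * p.2)%g v)) =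
   y t (u q.2^-1%g (adj (pi q.1) (pi p.1 (u p.2 v)))).
  rewrite -[LHS]bopME -yC; last exact: halpha.
  rewrite (repM hu) -[X in _ = y t X]/((u q.2^-1%g * (adj (pi q.1) * pi p.1)) (u p.2 v)).
  rewrite -[LHS]/(y t ((pi (alpha U q.2^-1 (adj q.1 * p.1)) * u q.2^-1%g) (u p.2 v))).
  rewrite cov_commute//.
  by rewrite (morM hpi)// ?(mor_adj hpi)//; exact: (cstar_adj hA).
by rewrite -(rep_adj hu) [rin (y t _) xi]rin_adj sy !rin_adjl.
Qed.

(** Only finitely many [theta_g] are nonzero, and each coefficient of F is bounded by
    the norm of the sum of F in B(H). The constant does not depend on F. *)
Lemma phi_bounded : exists C, forall F, coefs_in A F ->
  opnorm (phi F) <= C * opnorm (fsum U F).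
Proof.
pose E := [seq (s * t^-1)%g | s <- S, t <- S].
have theta0 g : g \notin undup E -> theta g = 0.
  rewrite mem_undup => gE; rewrite /theta big_seq big1// => s sS.
  have gs : (g^-1 * s)%g \notin S.
    apply: contra gE => tS; apply/allpairsP; exists (s, (g^-1 * s)%g).
    by split=> //=; rewrite invgM invgK mulgA mulgV mul1g.
  by rewrite (y0 gs) mulr0.
exists (\sum_(g <- undup E) opnorm (theta g)) => F AF.
pose r := undup (E ++ [seq p.2 | p <- F]).
have ur : uniq r := undup_uniq _.
have Fr p : p \in F -> p.2 \in r.
  by move=> pF; rewrite mem_undup mem_cat map_f ?orbT.
rewrite /phi (sum_regroup _ AF ur Fr) (le_trans (opnorm_sum _ _ _))// mulrC mulr_sumr.
rewrite -(@sum_supp _ _ (undup E) r) ?undup_uniq//; last first.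
- by move=> g /theta0 ->; rewrite opnorm0 mulr0.
- by move=> g; rewrite !mem_undup mem_cat => ->.
apply: ler_sum => g _; rewrite opnormM_le//.
rewrite (le_trans (mor_contractive hA hcomm hpi pi1 (coef_in g AF)))//.
exact: hcoef.
Qed.

(** With [F_0 = F] and [F_(k+1) = F_k* F_k] the Kadison-Schwarz inequality gives
    [|phi F|^(2^k) <= |phi F_k|], and [|phi F_k| <= C |F_k| = C |F|^(2^k)], where
    [|F|] is the norm of the sum of F in B(H). *)
Lemma phi_contractive F : coefs_in A F -> opnorm (phi F) <= opnorm (fsum U F).
Proof.
move=> AF; have [C phiC] := phi_bounded.
pose Fk k := iter k star F.
have AFk k : coefs_in A (Fk k) by elim: k => //= k; exact: star_in.
have fsumE k : opnorm (fsum U (Fk k)) = opnorm (fsum U F) ^+ (2 ^ k).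
  elim: k => [|k IH]; first by rewrite expn0 expr1.
  by rewrite /= fsum_star cstar_identity IH -exprM expnSr.
have schwarz F' : coefs_in A F' -> opnorm (phi F') ^+ 2 <= opnorm (phi (star F')).
  move=> AF'; have sq := sqrtr_ge0 (opnorm (phi (star F'))).
  rewrite -[leRHS]sqr_sqrtr ?opnorm_ge0// ler_sqr ?nnegrE ?opnorm_ge0//.
  apply: opnorm_le => // xi.
  rewrite -ler_sqr ?nnegrE ?mulr_ge0 ?hnorm_ge0// exprMn sqr_sqrtr ?opnorm_ge0//.
  rewrite (le_trans (phi_schwarz _ AF'))// (le_trans (rin_CS _ _))// expr2 mulrA.
  by rewrite ler_wpM2r ?hnorm_ge0// opnormP.
have phik k : opnorm (phi F) ^+ (2 ^ k) <= opnorm (phi (Fk k)).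
  elim: k => [|k IH]; first by rewrite expn0 expr1.
  rewrite expnSr exprM (le_trans _ (schwarz _ (AFk k)))//.
  by rewrite ler_sqr ?nnegrE ?exprn_ge0 ?opnorm_ge0.
apply: (@power_trick _ C); first exact: opnorm_ge0.
by move=> k; rewrite -fsumE (le_trans (phik k))// phiC.
Qed.

(** The difference is [pi (sum_s x_s d_s) u_g] with [d = delta_g * x - x], and the row
    of the [x_s] is a contraction. *)
Lemma theta_close g :
  opnorm (theta g - u g) <= norm2 (fun s => alpha U g (x (g^-1 * s)%g) - x s).
Proof.
pose d s := alpha U g (x (g^-1 * s)%g) - x s.
have Ad s : A (d s) by apply: (cstarB hA) => //; exact: halpha.
pose L := undup (S ++ [seq (g * t)%g | t <- S]).
have uL : uniq L := undup_uniq _.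
have d0 s : s \notin L -> d s = 0.
  rewrite mem_undup mem_cat negb_or => /andP[sS sgS].
  have gs : (g^-1 * s)%g \notin S.
    apply: contra sgS => tS; apply/mapP; exists (g^-1 * s)%g => //.
    by rewrite mulgA mulgV mul1g.
  by rewrite /d (xS sS) subr0 (xS gs) /alpha mulr0 mul0r.
have -> : theta g - u g = (\sum_(s <- S) y s * pi (d s)) * u g.
  rewrite -[X in _ - X]mul1r -y1 !big_distrl -sumrB; apply: eq_bigr => s _ /=.
  rewrite -!mulrA -mulrBr; congr (_ * _).
  rewrite -cov_commute// -mulrBl (morB hA hpi)//; exact: halpha.
have n0 : 0 <= norm2 d by exact: sqrtr_ge0.
rewrite -[leRHS]mulr1 opnormM_le ?(rep_opnorm hu)//.
apply: opnorm_le => // v; rewrite bop_sumE.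
rewrite -ler_sqr ?nnegrE ?mulr_ge0 ?hnorm_ge0//.
rewrite (le_trans (row_contraction _ (fun s _ => sy s) y1))//.
apply: (@le_trans _ _ (\sum_(s <- L) hnorm (pi (d s) v) ^+ 2)).
  apply: ler_sum_sub => //.
    by move=> s sS; rewrite mem_undup mem_cat sS.
  by move=> s; rewrite exprn_ge0 ?hnorm_ge0.
have Add s : A (d s * adj (d s)) by apply: (cstarM hA) => //; exact: (cstar_adj hA).
have -> : \sum_(s <- L) hnorm (pi (d s) v) ^+ 2 =
    rin (pi (\sum_(s <- L) d s * adj (d s)) v) v.
  rewrite (mor_sum hA hpi)// bop_sumE rin_suml; apply: eq_bigr => s _.
  rewrite hnorm_adjM -(mor_adj hpi)// -(morM hpi)//; last exact: (cstar_adj hA).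
  by rewrite hcomm//; exact: (cstar_adj hA).
rewrite exprMn sqr_sqrtr ?opnorm_ge0// (@fsum_seq _ _ L)//; last first.
  by move=> s /d0 ds; rewrite -/(d s) ds mul0r.
rewrite (le_trans (rin_CS _ _))// expr2 mulrA ler_wpM2r ?hnorm_ge0//.
rewrite (le_trans (opnormP _ _))// ler_wpM2r ?hnorm_ge0//.
by apply: (mor_contractive hA hcomm hpi pi1); exact: (cstar_sum hA).
Qed.

End Multiplier.

(** * The full crossed product is faithfully represented *)

Section FullNorm.
Variables (R : realType) (H : hilbertType R) (G : groupType).
Variables (A : set 'B(H)) (U : G -> 'B(H)).
Hypothesis hA : cstar_subalgebra A.
Hypothesis hcomm : forall a b, A a -> A b -> a * b = b * a.
Hypothesis hU : unitary_rep U.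
Hypothesis halpha : forall g b, A b -> A (alpha U g b).
Hypothesis hcoef : forall F (g : G), coefs_in A F ->
  opnorm (coef F g) <= opnorm (fsum U F).
Implicit Types (F : seq ('B(H) * G)) (g : G) (w : covariant_rep A (alpha U)).

(** The multipliers phi attached to the approximately invariant x_i converge pointwise to
    the representation w, and each of them is contractive for the norm of B(H). *)
Lemma amenable_norm_le w F : amenable_action A (alpha U) -> coefs_in A F ->
  opnorm (isum (@cov_pi _ _ _ _ _ w) (@cov_u _ _ _ _ _ w) F) <= opnorm (fsum U F).
Proof.
case: w => K pi u pi1 hpi hu hcov /= [x [xC xpos x1 xinv]] AF.
pose M := \sum_(p <- F) opnorm p.1.
have M0 : 0 <= M by apply: sumr_ge0 => p _; exact: opnorm_ge0.
apply/ler_addgt0Pr => e e0.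
have M1 : 0 < M + 1 by rewrite ltr_wpDl.
pose d := e / (M + 1); have d0 : 0 < d by rewrite divr_gt0.
pose gap i s := norm2 (fun g => alpha U s (x i (s^-1 * g)%g) - x i g).
have [N HN] : exists N, forall i, (N <= i)%N -> forall p, p \in F -> gap i p.2 <= d.
  clearbody d; elim: F {AF M M0 M1} => [|p F [N HN]]; first by exists 0%N.
  have /cvgrPdist_lt/(_ _ d0)[N' _ HN'] := xinv p.2.
  exists (maxn N N') => i; rewrite geq_max => /andP[Ni N'i] q.
  rewrite inE => /predU1P[->|]; last exact: HN.
  have := HN' i N'i; rewrite /= sub0r normrN => /(le_lt_trans (ler_norm _)).
  exact: ltW.
have [[/finite_supp_seq[S [uS xS]] Ax] _] := xC N.
have sx s : selfadj (x N s) by exact/positive_selfadj.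
have xS1 : \sum_(s <- S) x N s * x N s = 1.
  by rewrite -(x1 N) (fsum_seq uS)// => s /xS ->; rewrite expr2 mul0r.
pose th := theta pi u (x N) S.
have -> : isum pi u F = phi pi u (x N) S F - \sum_(p <- F) pi p.1 * (th p.2 - u p.2).
  rewrite /isum /phi -sumrB; apply: eq_bigr => p _.
  by rewrite -mulrBr opprB addrC subrK.
rewrite (le_trans (opnormB _ _))// lerD//.
  exact: (phi_contractive hA hcomm hU halpha hcoef pi1 hpi hu hcov uS Ax sx xS xS1).
rewrite (le_trans (opnorm_sum _ _ _))// (@le_trans _ _ (\sum_(p <- F) opnorm p.1 * d))//.
  rewrite big_seq [leRHS]big_seq; apply: ler_sum => p pF; apply: opnormM_le.
    exact: (mor_contractive hA hcomm hpi pi1 (AF _ pF)).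
  rewrite (le_trans _ (HN N _ p pF))//.
  exact: (theta_close hA hcomm halpha pi1 hpi hu hcov uS Ax sx xS xS1).
by rewrite -mulr_suml -/M /d mulrCA ger_pMr// ler_pdivrMr// mul1r lerDl.
Qed.

Lemma integrated_list f : Cc A f -> exists F, coefs_in A F /\
  forall w, integrated w f = isum (@cov_pi _ _ _ _ _ w) (@cov_u _ _ _ _ _ w) F.
Proof.
move=> [/finite_supp_seq[S [uS fS]] Af]; exists [seq (f g, g) | g <- S].
split=> [_ /mapP[g gS ->]|w]; first exact: Af.
have pi0 := mor0 hA (@cov_pi_morphism _ _ _ _ _ w).
rewrite /isum big_map /integrated (@fsbig_widen _ _ _ _ _ setT)//; last first.
  by move=> g [_ /negP]; rewrite /= negbK => /eqP ->; rewrite pi0 mul0r.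
by rewrite (fsum_seq uS)// => g /fS ->; rewrite pi0 mul0r.
Qed.

Lemma list_integrated F : coefs_in A F -> exists2 f, Cc A f &
  forall w, integrated w f = isum (@cov_pi _ _ _ _ _ w) (@cov_u _ _ _ _ _ w) F.
Proof.
move=> AF; pose r := undup [seq p.2 | p <- F].
have ur : uniq r := undup_uniq _.
have Fr p : p \in F -> p.2 \in r by move=> pF; rewrite mem_undup map_f.
have c0 g : g \notin r -> coef F g = 0.
  move=> gr; rewrite /coef big_seq_cond big1// => p /andP[/Fr pr /eqP pg].
  by rewrite -pg pr in gr.
exists (coef F) => [|w].
  split; last by move=> g; exact: (coef_in hA).
  apply: (sub_finite_set _ (finite_seq r)) => g /=.
  by apply: contraNT => /c0/eqP.
have hpi := @cov_pi_morphism _ _ _ _ _ w.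
have pi0 := mor0 hA hpi.
rewrite /isum (sum_regroup hA hpi _ AF ur Fr) /integrated.
rewrite (@fsbig_widen _ _ _ _ _ setT)//; last first.
  by move=> g [_ /negP]; rewrite /= negbK => /eqP ->; rewrite pi0 mul0r.
by rewrite (fsum_seq ur)// => g /c0 ->; rewrite pi0 mul0r.
Qed.

Definition sums_closure : set 'B(H) := [set T | forall e, 0 < e ->
  exists2 F, coefs_in A F & opnorm (T - fsum U F) <= e].

Lemma sums_closure_fsum F : coefs_in A F -> sums_closure (fsum U F).
Proof. by move=> AF e e0; exists F => //; rewrite subrr opnorm0 ltW. Qed.

Definition scale_list (c : R[i]) F := [seq (c *: p.1, p.2) | p <- F].

Lemma scale_list_in c F : coefs_in A F -> coefs_in A (scale_list c F).
Proof. by move=> AF _ /mapP[p pF ->]; apply: (cstarZ hA); exact: (AF _ pF). Qed.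

Lemma isum_scale (K : hilbertType R) (pi : 'B(H) -> 'B(K)) (u : G -> 'B(K)) c F :
  star_morphism A pi -> coefs_in A F ->
  isum pi u (scale_list c F) = c *: isum pi u F.
Proof.
move=> hpi AF; rewrite /isum big_map scaler_sumr; apply: eq_big_seq => p pF /=.
by rewrite (morZ hpi) ?bop_scalel//; exact: (AF _ pF).
Qed.

Lemma isum_cat (K : hilbertType R) (pi : 'B(H) -> 'B(K)) (u : G -> 'B(K)) F F' :
  isum pi u (F ++ F') = isum pi u F + isum pi u F'.
Proof. by rewrite /isum big_cat. Qed.

Lemma coefs_in_cat F F' : coefs_in A F -> coefs_in A F' -> coefs_in A (F ++ F').
Proof. by move=> AF AF' p; rewrite mem_cat => /orP[/AF|/AF']. Qed.

(** Products and adjoints of finite sums are finite sums by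
    [(a U_g) (b U_h) = a alpha_g(b) U_(g h)] and
    [adj (a U_g) = alpha_(g^-1)(adj a) U_(g^-1)]. *)
Lemma sums_closure_cstar : cstar_subalgebra sums_closure.
Proof.
have hid := id_star_morphism A.
split; first split.
- have -> : 1 = fsum U [:: (1, 1%g)] by rewrite /fsum big_seq1 mul1r (rep1 hU).
  apply: sums_closure_fsum => p; rewrite inE => /eqP->; exact: (cstar_one hA).
- move=> S T Sc Tc e e0; have e2 : 0 < e / 2 by rewrite divr_gt0.
  have [F AF SF] := Sc _ e2; have [F' AF' TF'] := Tc _ e2.
  exists (F ++ F'); first exact: coefs_in_cat.
  rewrite -[fsum U _]/(isum idfun U (F ++ F')) isum_cat opprD addrACA.
  by rewrite (le_trans (opnormD _ _))// [e in leRHS]splitr lerD.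
- move=> c T Tc e e0; have c1 : 0 < cabs c + 1 by rewrite ltr_wpDl ?cabs_ge0.
  have [|F AF TF] := Tc (e / (cabs c + 1)); first by rewrite divr_gt0.
  exists (scale_list c F); first exact: scale_list_in.
  rewrite -[fsum U _]/(isum idfun U _) isum_scale// -scalerBr opnormZ.
  rewrite (le_trans (ler_wpM2l (cabs_ge0 _) TF))//.
  by rewrite mulrCA ger_pMr// ler_pdivrMr// mul1r lerDl.
- move=> S T Sc Tc e e0.
  pose k := opnorm S + opnorm T + 1.
  have k0 : 0 < k by rewrite ltr_wpDl// addr_ge0 ?opnorm_ge0.
  pose d := Num.min 1 (e / k).
  have d0 : 0 < d by rewrite lt_min ltr01 divr_gt0.
  have [d1 dk] : d <= 1 /\ d <= e / k by split; rewrite ge_min lexx ?orbT.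
  have [F AF SF] := Sc _ d0; have [F' AF' TF'] := Tc _ d0.
  exists [seq (p.1 * alpha U p.2 q.1, (p.2 * q.2)%g) | p <- F, q <- F'].
    move=> _ /allpairsP[[p q] [pF qF' ->]] /=; apply: (cstarM hA).
      exact: (AF _ pF).
    by apply: halpha; exact: (AF' _ qF').
  have -> : fsum U [seq (p.1 * alpha U p.2 q.1, (p.2 * q.2)%g) | p <- F, q <- F'] =
      fsum U F * fsum U F'.
    rewrite /fsum big_allpairs_dep big_distrl; apply: eq_bigr => p _ /=.
    rewrite big_distrr; apply: eq_bigr => q _ /=.
    rewrite (repM hU) -!mulrA; congr (_ * _).
    by rewrite !mulrA -(alpha_commute hU).
  have -> : S * T - fsum U F * fsum U F' =
      (S - fsum U F) * T + fsum U F * (T - fsum U F').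
    by rewrite mulrBl mulrBr addrA subrK.
  have F1 : opnorm (fsum U F) <= opnorm S + 1.
    rewrite -[fsum U F](subrK S) addrC (le_trans (opnormD _ _))// lerD2l.
    by rewrite opnormBC (le_trans SF).
  rewrite (le_trans (opnormD _ _))//.
  rewrite (le_trans (lerD (opnormM_le SF (lexx _)) (opnormM_le F1 TF')))//.
  rewrite (_ : _ + _ = d * k); last by rewrite /k; ring.
  by rewrite -ler_pdivlMr.
- move=> T Tc e e0; have [F AF TF] := Tc _ e0.
  exists [seq (alpha U p.2^-1%g (adj p.1), p.2^-1%g) | p <- F].
    move=> _ /mapP[p pF ->] /=; apply/halpha/(cstar_adj hA); exact: (AF _ pF).
  have -> : fsum U [seq (alpha U p.2^-1%g (adj p.1), p.2^-1%g) | p <- F] =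
      adj (fsum U F).
    rewrite /fsum big_map adj_sum; apply: eq_bigr => p _ /=.
    by rewrite adjM (rep_adj hU) -(alpha_commute hU).
  by rewrite -adjB opnorm_adj.
- move=> T Tc e e0; have e2 : 0 < e / 2 by rewrite divr_gt0.
  have [S Sc TS] := Tc _ e2; have [F AF SF] := Sc _ e2.
  exists F => //; rewrite (le_trans (opnorm_tri S _ _))// [e in leRHS]splitr.
  by rewrite lerD// ltW.
Qed.

Lemma generated_sums_closure : generated_cstar A U `<=` sums_closure.
Proof.
apply: smallest_sub; first exact: sums_closure_cstar.
move=> T [AT|[g _ <-]].
  have -> : T = fsum U [:: (T, 1%g)] by rewrite /fsum big_seq1 (rep1 hU) mulr1.
  by apply: sums_closure_fsum => p; rewrite inE => /eqP->.
have -> : U g = fsum U [:: (1, g)] by rewrite /fsum big_seq1 mul1r.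
by apply: sums_closure_fsum => p; rewrite inE => /eqP->; exact: (cstar_one hA).
Qed.

Local Notation wid := (id_covariant_rep A hU).
Local Notation idU := (@id_rtimes_U R H G A U hU).

Lemma id_rtimes_U_generated T : full_crossed_product T ->
  generated_cstar A U (idU T).
Proof.
move=> fT C [/= hC AUC]; apply: (cstar_closed hC) => e e0.
have [f Cf fTe] := fT _ e0; exists (integrated wid f); last exact: (fTe wid).
have [F [AF ->]] := integrated_list Cf.
apply: (cstar_sum_seq hC) => p pF; apply: (cstarM hC); apply: AUC.
  by left; exact: (AF _ pF).
by right; exists p.2.
Qed.

(** By amenable_norm_le, the difference of two approximants is as small in every
    covariant representation as it is in B(H). *)
Lemma id_rtimes_U_injective S T : amenable_action A (alpha U) ->
  full_crossed_product S -> full_crossed_product T ->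
  idU S = idU T -> S = T.
Proof.
move=> am fS fT ST; apply: functional_extensionality_dep => w.
apply/eqP; rewrite -subr_eq0; apply/eqP; apply: (@opnorm_small _ _ _ 4) => e e0.
have [f Cf Sf] := fS _ e0; have [f' Cf' Tf'] := fT _ e0.
have [F [AF fF]] := integrated_list Cf; have [F' [AF' f'F']] := integrated_list Cf'.
pose D := F ++ scale_list (- 1) F'.
have AD : coefs_in A D by apply: coefs_in_cat => //; exact: scale_list_in.
have DE (v : covariant_rep A (alpha U)) :
    isum (@cov_pi _ _ _ _ _ v) (@cov_u _ _ _ _ _ v) D =
    integrated v f - integrated v f'.
  rewrite isum_cat (isum_scale _ _ (@cov_pi_morphism _ _ _ _ _ v) AF').
  by rewrite scaleN1r -fF -f'F'.
have idD : opnorm (fsum U D) <= 2 * e.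
  rewrite -[fsum U D]/(isum (@cov_pi _ _ _ _ _ wid) (@cov_u _ _ _ _ _ wid) D) DE.
  rewrite (le_trans (opnorm_tri (S wid) _ _))// mulr2n mulrDl mul1r lerD//.
    by rewrite opnormBC Sf.
  by rewrite [S wid]ST Tf'.
have wD : opnorm (integrated w f - integrated w f') <= 2 * e.
  by rewrite -DE (le_trans (amenable_norm_le w am AD)).
rewrite (le_trans (opnorm_tri (integrated w f) _ _))//.
have -> : 4 * e = e + (2 * e + e) by ring.
rewrite lerD ?Sf// (le_trans (opnorm_tri (integrated w f') _ _))// lerD//.
by rewrite opnormBC Tf'.
Qed.

(** Finite sums converging to b form, by amenable_norm_le, a sequence that is Cauchy
    uniformly over all covariant representations; its limits make up a preimage. *)
Lemma id_rtimes_U_surjective b : amenable_action A (alpha U) ->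
  generated_cstar A U b ->
  exists2 T, full_crossed_product T & idU T = b.
Proof.
move=> am /generated_sums_closure bc.
have /choice[F FP] n : exists F, coefs_in A F /\
    opnorm (b - fsum U F) <= n.+1%:R^-1.
  by have [|F AF bF] := bc n.+1%:R^-1; [rewrite invr_gt0|exists F].
have AF n : coefs_in A (F n) by have [] := FP n.
have bF n : opnorm (b - fsum U (F n)) <= n.+1%:R^-1 by have [] := FP n.
pose J w n := isum (@cov_pi _ _ _ _ _ w) (@cov_u _ _ _ _ _ w) (F n).
have JB w m n : opnorm (J w m - J w n) <= m.+1%:R^-1 + n.+1%:R^-1.
  pose D := F m ++ scale_list (- 1) (F n).
  have AD : coefs_in A D by apply: coefs_in_cat => //; exact: scale_list_in.
  have DE (K : hilbertType R) (pi : 'B(H) -> 'B(K)) u : star_morphism A pi ->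
      isum pi u D = isum pi u (F m) - isum pi u (F n).
    by move=> hpi; rewrite isum_cat isum_scale// scaleN1r.
  rewrite -(DE _ _ _ (@cov_pi_morphism _ _ _ _ _ w)).
  rewrite (le_trans (amenable_norm_le w am AD))//.
  rewrite -[fsum U D]/(isum idfun U D) DE//.
  by rewrite (le_trans (opnorm_tri b _ _))// lerD ?bF// opnormBC bF.
have Jlim w : exists T, forall e, 0 < e -> exists N, forall n, (N <= n)%N ->
    opnorm (J w n - T) <= e.
  apply: opnorm_complete => e e0.
  have [|N HN] := @inv_nat_small R (e / 2); first by rewrite divr_gt0.
  exists N => m n Nm Nn; rewrite (le_trans (JB _ _ _))// [e]splitr.
  by rewrite lerD ?HN.
pose T : rep_family A (alpha U) := fun w => sval (cid (Jlim w)).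
have TP w e : 0 < e -> exists N, forall n, (N <= n)%N -> opnorm (J w n - T w) <= e.
  by move: e; rewrite /T; case: cid.
have TJ w n : opnorm (T w - J w n) <= n.+1%:R^-1.
  apply/ler_addgt0Pr => e e0; have e2 : 0 < e / 2 by rewrite divr_gt0.
  have [N1 HN1] := TP w _ e2; have [N2 HN2] := inv_nat_small e2.
  pose m := maxn N1 N2.
  have := opnorm_tri (J w m) (T w) (J w n); have := JB w m n.
  have := HN1 m (leq_maxl _ _); have := HN2 m (leq_maxr _ _).
  rewrite [opnorm (T w - J w m)]opnormBC.
  move: (opnorm _) (opnorm _) (opnorm _) (m.+1%:R^-1) (n.+1%:R^-1) => *; lra.
exists T.
  move=> e e0; have [n HN] := inv_nat_small e0.
  have [f Cf fF] := list_integrated (AF n); exists f => // w.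
  by rewrite fF (le_trans (TJ w n))// HN.
apply/eqP; rewrite -subr_eq0; apply/eqP; apply: (@opnorm_small _ _ _ 2) => e e0.
have [n HN] := inv_nat_small e0.
rewrite (le_trans (opnorm_tri (J wid n) _ _))// mulr2n mulrDl mul1r lerD//.
  by rewrite (le_trans (TJ wid n))// HN.
by rewrite opnormBC (le_trans (bF n))// HN.
Qed.

End FullNorm.

Theorem theorem2 (R : realType) (H : hilbertType R) (G : groupType)
    (A : set 'B(H)) (U : G -> 'B(H))
    (hA : cstar_subalgebra A)
    (hcomm : forall a b, A a -> A b -> a * b = b * a)
    (hU : unitary_rep U)
    (halpha : forall g, star_automorphism A (alpha U g))
    (hyp : forall (G0 : set G) (c : G -> R[i]) (V : set (character A)),
      finite_set G0 -> ~ G0 1%g -> open V -> V !=set0 ->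
      (forall g, G0 g -> forall m, V m -> beta hA (halpha g) m = m) ->
      exists2 z, bumps V z &
        opnorm z <= opnorm (z * (1 + \sum_(g \in G0) c g *: U g))) :
  (forall (D : set G) (V : set (character A)) (a : G -> 'B(H)),
     finite_set D -> open V -> V !=set0 ->
     (forall g, D g -> forall m, V m -> beta hA (halpha g) m = m) ->
     (forall g, D g -> A (a g)) ->
     exists2 z, bumps V z &
       opnorm (z * (if 1%g \in D then a 1%g else 0)) <=
       opnorm (z * \sum_(g \in D) a g * U g)) /\
  (amenable_action A (alpha U) ->
     crossed_star_isomorphism (generated_cstar A U) (@id_rtimes_U R H G A U hU)).
Proof.
have halphaA g b : A b -> A (alpha U g b) by exact: alpha_in.
have hcoef F g : coefs_in A F -> opnorm (coef F g) <= opnorm (fsum U F).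
  exact: (coef_contractive hcomm hU hyp).
split=> [D V a finD oV V0 fixV Aa|am].
  have [z Vz] := bump_exists hyp oV V0; have [Az _ _ _] := Vz.
  exists z => //; case: ifPn => D1; last by rewrite mulr0 opnorm0 opnorm_ge0.
  have /finite_seqP[r rD] := finD.
  have DE : D = [set` undup r].
    by rewrite rD; apply/seteqP; split=> g /=; rewrite mem_undup.
  have memD g : g \in undup r -> D g by rewrite DE.
  rewrite DE -fsbig_seq ?undup_uniq//.
  apply: (fixed_points_estimate hcomm hU hyp _ _ _ oV _ Az) => //.
  - exact: undup_uniq.
  - by move: D1; rewrite inE DE.
  - by move=> g /memD; exact: Aa.
  - by move=> g /memD; exact: fixV.
  - by move=> chi; exact: bumps_supp.
split; split=> //.
- exact: id_rtimes_U_generated.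
- by move=> S T fS fT; exact: (id_rtimes_U_injective hA hcomm halphaA hcoef am fS fT).
- by move=> b; exact: (id_rtimes_U_surjective hA hcomm hU halphaA hcoef am).
Qed.
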